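(* Let $R$ be a proper rational fraction of degree $n$ with pairwise distinct poles $r_ke^{i\varphi_k}$ of multiplicity $n_k$, $k=1,\dots,\nu$, $\sum_{k=1}^{\nu}n_k=n$, where $r_k>0$ and $\varphi_k\in(0,2\pi)$ (so the poles do not belong to the real semiaxis $\mathbb R^+$). Put $z_k=\sqrt{r_k}\,e^{i\varphi_k/2}$ and $$B_*(x)=\prod_{k=1}^{\nu}\left(\frac{x-z_k}{x-\overline{z_k}}\cdot\frac{x+\overline{z_k}}{x+z_k}\right)^{n_k},$$ $$\mu_*(x)=\sum_{k=1}^{\nu}\left(\frac{n_k\sqrt{r_k}\,\sin(\varphi_k/2)}{|x-\sqrt{r_k}e^{i\varphi_k/2}|^2}+\frac{n_k\sqrt{r_k}\,\sin(\varphi_k/2)}{|x+\sqrt{r_k}e^{-i\varphi_k/2}|^2}\right).$$ For $m\in\mathbb N$ and $\varphi\in\mathbb R$ let $x_k(m,\varphi)$, $k=1,\dots,2mn$, be the (real) notches, i.e. the roots of the equation $B_*^m(x)=e^{i\varphi}$. Then $$\int_{\mathbb R^+}\frac{R(x)}{\sqrt x}\,dx=\pi\sum_{k=1}^{2n}\frac{R(x_k^2)}{\mu_*(x_k)},\qquad x_k=x_k(1,\varphi),$$ $$\|R\|_{L^{2m}(\mathbb R^+;\frac1{\sqrt x})}^{2m}:=\int_{\mathbb R^+}\frac{|R(x)|^{2m}}{\sqrt x}\,dx=\frac{\pi}{m}\sum_{k=1}^{2mn}\frac{|R(x_k^2)|^{2m}}{\mu_*(x_k)},\qquad x_k=x_k(m,\varphi).$$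 In the case $\varphi\equiv 0\ (\mathrm{mod}\ 2\pi)$ one of the notches is at infinity (the corresponding summand being understood as the limit as $x\to\infty$).
   Context: A proper rational fraction is a quotient $P/Q$ of polynomials with $\deg P<\deg Q$; its degree is the number of its poles counted with multiplicity. $\mathbb R^+=[0,\infty)$. For each $m,\varphi$ the equation $B_*^m(x)=e^{i\varphi}$ has exactly $2mn$ distinct roots in $\mathbb R\cup\{\infty\}$ (where $B_*(\infty)=1$). *)

(* Defs.v *)
From HB Require Import structures.
From mathcomp Require Import all_boot all_order all_algebra.
From mathcomp Require Import all_classical all_reals all_analysis.
From mathcomp Require Import complex.

Set Implicit Arguments.
Unset Strict Implicit.
Unset Printing Implicit Defensive.

Import Order.TTheory GRing.Theory Num.Theory.
Import numFieldNormedType.Exports.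

Local Open Scope classical_set_scope.
Local Open Scope ring_scope.
Local Open Scope complex_scope.

Definition expi {R : realType} (t : R) : R[i] := cos t +i* sin t.

Definition polar {R : realType} (r t : R) : R[i] := r%:C * expi t.

(* [P / Q] is in lowest terms, so that its poles are the roots of [Q], with
   the same multiplicities. *)
Definition proper_fraction {R : realType} (P Q : {poly R[i]}) : Prop :=
  [/\ Q != 0, coprimep P Q & (size P < size Q)%N].

Definition rfrac {R : realType} (P Q : {poly R[i]}) (z : R[i]) : R[i] :=
  P.[z] / Q.[z].

Definition has_poles {R : realType} (Q : {poly R[i]}) (nu : nat)
    (p : 'I_nu -> R[i]) (mult : 'I_nu -> nat) : Prop :=
  [/\ injective p, forall z, root Q z <-> exists k, p k = z
    & forall k, mup (p k) Q = mult k].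

Section blaschke.
Context {R : realType} (nu : nat) (r phi : 'I_nu -> R) (mult : 'I_nu -> nat).

Definition zpt (k : 'I_nu) : R[i] := polar (Num.sqrt (r k)) (phi k / 2).

Definition Bstar (x : R) : R[i] :=
  \prod_(k < nu)
    ((x%:C - zpt k) / (x%:C - (zpt k)^*) *
     ((x%:C + (zpt k)^*) / (x%:C + zpt k))) ^+ mult k.

Definition mustar (x : R) : R :=
  \sum_(k < nu)
    ((mult k)%:R * Num.sqrt (r k) * sin (phi k / 2) /
       Normc.normc (x%:C - polar (Num.sqrt (r k)) (phi k / 2)) ^+ 2 +
     (mult k)%:R * Num.sqrt (r k) * sin (phi k / 2) /
       Normc.normc (x%:C + polar (Num.sqrt (r k)) (- (phi k / 2))) ^+ 2).

(* Points of the line completed by a single point at infinity, [None]. *)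
Definition Bstar_infty (y : option R) : R[i] := oapp Bstar 1 y.

(* [x] lists, without repetition, all the roots of [B_*^m = e^(i t)] in the
   completed line. *)
Definition notches (m : nat) (t : R) (N : nat) (x : 'I_N -> option R) : Prop :=
  injective x /\
  forall y, Bstar_infty y ^+ m = expi t <-> exists k, x k = y.

End blaschke.

(* Trace on [R] of the neighborhoods of the point at infinity. *)
Definition infty_nbhs (R : realType) : set_system R :=
  filter_from [set: R] (fun M => [set x | M < `|x|]).
Arguments infty_nbhs R : clear implicits.

(* Value of a summand at a point of the completed line: a limit at infinity. *)
Definition at_notch {R : realType} {T : ptopologicalType} (f : R -> T)
    (y : option R) : T :=
  oapp f (lim (f x @[x --> infty_nbhs R])) y.

(* The topology of [R[i]] is carried by its alias [R[i]^o]. *)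
Definition at_notchC {R : realType} (f : R -> R[i]) (y : option R) : R[i] :=
  @at_notch R R[i]^o f y.

Definition has_integralC {R : realType} (D : set R) (f : R -> R[i]) (v : R[i])
    : Prop :=
  [/\ (@lebesgue_measure R).-integrable D (fun x => (complex.Re (f x))%:E),
      (@lebesgue_measure R).-integrable D (fun x => (complex.Im (f x))%:E)
    & v = Rintegral (@lebesgue_measure R) D (fun x => complex.Re (f x)) +i*
          Rintegral (@lebesgue_measure R) D (fun x => complex.Im (f x))].

(* Main.v *)
Require Import Defs.
From HB Require Import structures.
From mathcomp Require Import all_boot all_order all_algebra.
From mathcomp Require Import all_classical all_reals all_analysis.
From mathcomp Require Import complex.
From mathcomp Require Import measurable_realfun ring lra zify separable.

Set Implicit Arguments.
Unset Strict Implicit.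
Unset Printing Implicit Defensive.

Import Order.TTheory GRing.Theory Num.Theory.
Import numFieldNormedType.Exports.

Local Open Scope classical_set_scope.
Local Open Scope ring_scope.
Local Open Scope complex_scope.

(* The substitution [x = y^2] turns the integrals over the half line into integrals
   over the whole line of even rational functions [G = A / (H K)], where the zeros
   [z] of [H] lie in the upper half plane, [K] is the conjugate of [H] and
   [deg A <= 2 deg H - 2]. Write [G = U / H + V / K] with [deg U, deg V < N = deg H],
   and let [u = U_(N-1) = - V_(N-1)] be the residue sum over the upper half plane.
   Partial fractions and explicit primitives give [\int G = 2 pi i u]. On the other
   hand [B = H / K] has modulus [1] on the line and [B' / B = i theta'] with
   [theta' = \sum_z 2 Im z / |x - z|^2], so the solutions of [B = w] are the simple
   roots of [q = H - w K], where [G / theta' = i (U + w V) / q']. Lagrange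
   interpolation sums these values to a ratio of leading coefficients, namely
   [i (u + w v) / (1 - w) = i u] with [v = - u], hence
   [\int G = 2 pi \sum_(B x = w) G x / theta' x]. For [B = Bstar ^+ m] one has
   [theta' = 2 m mustar]. *)

(** * Polynomials *)

(** The denominator [Q (x^2)] of [R (x^2)] has the zeros [z_k] and [- z_k], one in each half plane,
    so it is not of the shape [H K]. Multiplying above and below by its conjugate on the line gives
    [|Q (x^2)|^2], whose four factors for each [k] regroup into [(x - z_k) (x + conj z_k)] for [H]
    and the conjugate pair for [K]. This is why [Bstar] has twice as many zeros as [R] has poles.
    The new numerator has degree at most [4 n - 2], exactly the bound that forces [v = - u]. Since
    [|R (x^2)|^(2 m)] is likewise rational on the line, with [H] raised to the power [m], a single
    quadrature serves both formulas. The term [U / H] decays only like [u / x], so it is not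
    integrable by itself. The statement carried through the partial fractions is therefore that
    [U / H - u / (x - i)] has integral zero. Only [u] survives, and the residues at multiple poles
    are never computed. An integral over the line is recorded by a primitive with its two limits,
    which gives the value, and by a bound [C / (1 + x^2)], which gives absolute convergence; both
    pass to linear combinations. *)

Section polynomials.
Variable F : fieldType.
Implicit Types p q : {poly F}.

Lemma coefM_top p q a b : (size p <= a.+1)%N -> (size q <= b.+1)%N ->
  (p * q)`_(a + b) = p`_a * q`_b.
Proof.
move=> pa qb; rewrite coefM.
have ha : (a < (a + b).+1)%N by rewrite ltnS leq_addr.
rewrite (bigD1 (Ordinal ha)) //= addKn big1 ?addr0 // => i /eqP ia.
have {}ia : (i : nat) <> a by move=> e; apply: ia; apply: val_inj.
have [ai|ia'|//] := ltngtP i a.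
  rewrite [q`__]nth_default ?mulr0 // (leq_trans qb) //.
  by rewrite ltn_subRL ltn_add2r.
by rewrite [p`__]nth_default ?mul0r // (leq_trans pa).
Qed.

Lemma deriv_prod_XsubC_root (rs : seq F) z : z \in rs ->
  (\prod_(y <- rs) ('X - y%:P))^`().[z] =
  (\prod_(y <- rem z rs) ('X - y%:P)).[z].
Proof.
move=> zrs; rewrite (big_rem z) //= derivM derivXsubC mul1r.
by rewrite hornerD hornerM hornerXsubC subrr mul0r addr0.
Qed.

Lemma horner_deriv_prod (rs : seq F) (a : F) :
  (\prod_(z <- rs) ('X - z%:P)).[a] != 0 ->
  (\prod_(z <- rs) ('X - z%:P))^`().[a] =
  (\prod_(z <- rs) ('X - z%:P)).[a] * \sum_(z <- rs) (a - z)^-1.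
Proof.
elim: rs => [|z rs IH]; first by rewrite !big_nil mulr0 derivC horner0.
rewrite !big_cons derivM derivXsubC mul1r hornerD !hornerM hornerXsubC.
by rewrite mulf_eq0 negb_or => /andP[az /IH ->]; field.
Qed.

(** The Lagrange basis polynomials are scalar multiples of the monic [T z] of degree [(size rs).-1];
    comparing coefficients of that degree gives the sum. *)
Lemma sum_lagrange (rs : seq F) p : uniq rs -> (size p <= size rs)%N ->
  \sum_(z <- rs) p.[z] / (\prod_(y <- rs) ('X - y%:P))^`().[z] =
  p`_(size rs).-1.
Proof.
move=> urs szp.
pose T z := \prod_(y <- rem z rs) ('X - y%:P).
have szT z : z \in rs -> size (T z) = size rs.
  move=> zrs; rewrite size_prod_XsubC size_rem //.
  by case: rs zrs {T urs szp}.
pose L := \sum_(z <- rs) (p.[z] / (T z).[z]) *: T z.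
have TN0 z : z \in rs -> (T z).[z] != 0.
  move=> zrs; rewrite -[_ == 0]/(root _ _) root_prod_XsubC.
  by rewrite mem_rem_uniqF.
(* Both sides have size at most [size rs] and agree at the [size rs] distinct nodes. *)
have pL : p = L.
  apply/eqP; rewrite -subr_eq0; apply/eqP.
  apply: (@roots_geq_poly_eq0 _ _ rs) => //.
    apply/allP => y yrs; rewrite rootE hornerD hornerN subr_eq0; apply/eqP.
    rewrite horner_sum (bigD1_seq y) //= hornerZ divfK ?TN0 //.
    rewrite big1_seq ?addr0 // => z /andP[zy zrs]; rewrite hornerZ.
    have /rootP -> : root (T z) y; last by rewrite mulr0.
    by rewrite root_prod_XsubC rem_filter // mem_filter /= eq_sym zy.
  rewrite (leq_trans (size_polyD _ _)) // geq_max szp size_polyN.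
  rewrite (leq_trans (size_sum _ _ _)) //.
  apply/bigmax_leqP_seq => z zrs _.
  by rewrite (leq_trans (size_scale_leq _ _)) // szT.
rewrite [in RHS]pL coef_sum; apply: eq_big_seq => z zrs.
rewrite deriv_prod_XsubC_root // coefZ.
have : lead_coef (T z) = 1 by apply/eqP; rewrite -monicE monic_prod_XsubC.
by rewrite lead_coefE szT // => ->; rewrite mulr1.
Qed.

(** From a Bezout relation [a p + b q = 1], reducing [A b] modulo [p] fixes [U]. Then [p] divides
    [A - U q], and the bound on [A] controls the degree of the quotient [V]. *)
Lemma coprimep_decomp p q (A : {poly F}) N : size p = N.+1 -> size q = N.+1 ->
  coprimep p q -> (size A <= N + N)%N ->
  exists U V : {poly F}, [/\ (size U <= N)%N, (size V <= N)%N & A = U * q + V * p].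
Proof.
move=> szp szq cpq szA.
have p0 : p != 0 by rewrite -size_poly_gt0 szp.
have q0 : q != 0 by rewrite -size_poly_gt0 szq.
have /Bezout_eq1_coprimepP[[a b]/= ab] := cpq.
pose U := (A * b) %% p.
have szU : (size U <= N)%N by rewrite -ltnS -szp ltn_modp.
have dv : p %| A - U * q.
  have -> : A - U * q = ((A * b) %/ p * q + A * a) * p.
    rewrite -[A in A - _]mulr1 -ab /U.
    have -> : A * b %% p = A * b - A * b %/ p * p.
      by rewrite [X in _ = X - _](divp_eq (A * b) p) addrAC subrr add0r.
    ring.
  exact: dvdp_mull.
exists U, ((A - U * q) %/ p); split => //; last first.
  by rewrite divpK // addrC subrK.
rewrite size_divp // szp /= leq_subLR.
rewrite (leq_trans (size_polyD _ _)) // geq_max szA size_polyN.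
have [->|U0] := eqVneq U 0; first by rewrite mul0r size_poly0.
by rewrite size_mul // szq addnS /= leq_add2r.
Qed.

End polynomials.

Lemma closed_coprimep (F : closedFieldType) (p q : {poly F}) :
  p != 0 -> (forall z, root p z -> root q z -> False) -> coprimep p q.
Proof.
move=> p0 pq; rewrite coprimep_def; apply/negPn/negP => sz.
have g0 : gcdp p q != 0 by rewrite gcdp_eq0 negb_and p0.
have /closed_rootP[z] := sz.
by rewrite root_gcd => /andP[/pq].
Qed.

(** * Blaschke products and their notches *)

Section blaschke_product.
Variable R : realType.
Implicit Types (s : seq R[i]) (w y z : R[i]) (x : R).

Definition upper_half_plane s := all (fun z => 0 < complex.Im z) s.

Definition num_poly s : {poly R[i]} := \prod_(z <- s) ('X - z%:P).
Definition den_poly s : {poly R[i]} := \prod_(z <- s) ('X - (z^*)%:P).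
Definition notch_poly s w := num_poly s - w *: den_poly s.

(* The derivative of the argument of [blaschke s] along the real line. *)
Definition phase_deriv s x : R :=
  \sum_(z <- s) 2 * complex.Im z / Normc.normc (x%:C - z) ^+ 2.

(** The limit of [x ^+ 2 * phase_deriv s x] at infinity, and, up to the factor [- 'i], the leading
    coefficient of [notch_poly s 1]. *)
Definition total_phase s : R := \sum_(z <- s) 2 * complex.Im z.

Lemma size_num_poly s : size (num_poly s) = (size s).+1.
Proof. exact: size_prod_XsubC. Qed.

Lemma size_den_poly s : size (den_poly s) = (size s).+1.
Proof.
by rewrite /den_poly -(big_map conjc xpredT (fun z => 'X - z%:P))
   size_prod_XsubC size_map.
Qed.

Lemma num_poly_top s : (num_poly s)`_(size s) = 1.
Proof.
have /monicP : num_poly s \is monic by exact: monic_prod_XsubC.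
by rewrite lead_coefE size_num_poly.
Qed.

Lemma den_poly_top s : (den_poly s)`_(size s) = 1.
Proof.
have /monicP : den_poly s \is monic by exact: monic_prod_XsubC.
by rewrite lead_coefE size_den_poly.
Qed.

Lemma horner_num_poly s y : (num_poly s).[y] = \prod_(z <- s) (y - z).
Proof. by rewrite horner_prod; apply: eq_bigr => z _; rewrite hornerXsubC. Qed.

Lemma horner_den_poly s y : (den_poly s).[y] = \prod_(z <- s) (y - z^*).
Proof. by rewrite horner_prod; apply: eq_bigr => z _; rewrite hornerXsubC. Qed.

Lemma conj_num_poly s y : ((num_poly s).[y])^* = (den_poly s).[y^*].
Proof.
rewrite horner_num_poly horner_den_poly rmorph_prod.
by apply: eq_bigr => z _; rewrite rmorphB.
Qed.

Lemma conj_num_poly_real s x : ((num_poly s).[x%:C])^* = (den_poly s).[x%:C].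
Proof. by rewrite conj_num_poly; congr _.[_]; exact: conjc_real. Qed.

Lemma Im_neq0_sub x z : complex.Im z != 0 -> x%:C - z != 0.
Proof.
apply: contraNneq => /eqP; rewrite subr_eq0 => /eqP <- //.
Qed.

Lemma num_poly_neq0 s x : upper_half_plane s -> (num_poly s).[x%:C] != 0.
Proof.
move=> /allP us; rewrite horner_num_poly prodf_seq_neq0; apply/allP => z zs /=.
by rewrite Im_neq0_sub ?gt_eqF ?us.
Qed.

Lemma den_poly_neq0 s x : upper_half_plane s -> (den_poly s).[x%:C] != 0.
Proof. by move=> us; rewrite -conj_num_poly_real conjc_eq0 num_poly_neq0. Qed.

Lemma sqr_normc_coords z :
  Normc.normc z ^+ 2 = complex.Re z ^+ 2 + complex.Im z ^+ 2.
Proof. by case: z => a b /=; rewrite sqr_sqrtr // addr_ge0 ?sqr_ge0. Qed.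

Lemma ltr_dist_conj y z : 0 < complex.Im y -> 0 < complex.Im z ->
  `|y - z| < `|y - z^*|.
Proof.
case: y z => a b [c d] /= b0 d0; rewrite normc_def /= normc_def /= ltcR.
rewrite ltr_sqrt; first by rewrite ltrD2l; nra.
rewrite ltr_wpDl ?sqr_ge0 // opprK exprn_gt0 // addr_gt0 //.
Qed.

Lemma ltr_num_den y s : s != [::] -> upper_half_plane s -> 0 < complex.Im y ->
  `|(num_poly s).[y]| < `|(den_poly s).[y]|.
Proof.
move=> s0 /allP us y0; rewrite horner_num_poly horner_den_poly !normr_prod.
rewrite big_seq [X in _ < X]big_seq. apply: ltr_prod.
  by case: (s) s0 => [|z s1] // _; apply/hasP; exists z; rewrite mem_head.
by move=> z /us z0; rewrite normr_ge0 ltr_dist_conj.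
Qed.

(** A point of the upper half plane is closer to each [z] than to its conjugate, so [|B| < 1] there.
    By reflection [|B| > 1] in the lower half plane, and a unimodular value can only be taken on the
    line. *)
Lemma root_notch_poly_real s w y : s != [::] -> upper_half_plane s ->
  `|w| = 1 -> root (notch_poly s w) y -> complex.Im y = 0.
Proof.
move=> s0 us w1; rewrite rootE hornerD hornerN hornerZ subr_eq0 => /eqP e.
have {}e : `|(num_poly s).[y]| = `|(den_poly s).[y]|.
  by rewrite e normrM w1 mul1r.
have [y0|y0|//] := ltgtP (complex.Im y) 0.
  have := @ltr_num_den (y^*) _ s0 us; rewrite -conj_num_poly normcJ.
  have -> : (num_poly s).[y^*] = ((den_poly s).[y])^*.
    by rewrite -[in RHS](conjcK y) -conj_num_poly conjcK.
  rewrite normcJ e ltxx; case: y y0 {e} => a b /= b0.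
  by rewrite oppr_gt0 => /(_ b0).
by have := ltr_num_den s0 us y0; rewrite e ltxx.
Qed.

Lemma subc_norm x z : (x%:C - z) * (x%:C - z^*) = (Normc.normc (x%:C - z) ^+ 2)%:C.
Proof.
have -> : x%:C - z^* = (x%:C - z)^*.
  by rewrite rmorphB; congr (_ - _); rewrite -[LHS]conjc_real.
by rewrite -sqr_normc normc_def rmorphXn /=; case: z => a b.
Qed.

Lemma phase_derivE s x : upper_half_plane s -> 'i%C * (phase_deriv s x)%:C =
  \sum_(z <- s) (x%:C - z)^-1 - \sum_(z <- s) (x%:C - z^*)^-1.
Proof.
move=> /allP us; rewrite -sumrB rmorph_sum mulr_sumr.
apply: eq_big_seq => z /us z0.
have zN0 : x%:C - z != 0 by rewrite Im_neq0_sub // gt_eqF.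
have zcN0 : x%:C - z^* != 0.
  by rewrite Im_neq0_sub //; case: z z0 {zN0} => a b /= b0; rewrite oppr_eq0 gt_eqF.
rewrite fmorph_div /= -subc_norm rmorphM rmorph_nat /=.
have -> : (x%:C - z)^-1 - (x%:C - z^*)^-1 =
    (z - z^*) / ((x%:C - z) * (x%:C - z^*)) by field; rewrite zN0 zcN0.
by rewrite subcJ; field; rewrite zN0 zcN0.
Qed.

Lemma complexi_neq0 : 'i%C != 0 :> R[i].
Proof. by rewrite eq_complex /= oner_eq0 andbF. Qed.

Lemma phase_deriv_gt0 s x : s != [::] -> upper_half_plane s ->
  0 < phase_deriv s x.
Proof.
have pos z : 0 < complex.Im z ->
    0 < 2 * complex.Im z / Normc.normc (x%:C - z) ^+ 2.
  move=> z0; apply: divr_gt0; [exact: mulr_gt0|rewrite sqr_normc_coords].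
  by case: z z0 => a b /= b0; rewrite ltr_wpDl ?sqr_ge0 // sub0r sqrrN exprn_gt0.
case: s => // z s _ /= /andP[z0 /allP us].
rewrite /phase_deriv big_cons ltr_pwDl ?pos // big_seq sumr_ge0 // => y /us y0.
by rewrite ltW ?pos.
Qed.

(** At a root, [w *: den_poly s] and [num_poly s] have the same value, which factors out of the
    derivative and leaves the difference of the two logarithmic derivatives. *)
Lemma notch_poly_deriv s w x : upper_half_plane s ->
  root (notch_poly s w) x%:C -> (notch_poly s w)^`().[x%:C] =
  'i%C * (phase_deriv s x)%:C * (num_poly s).[x%:C].
Proof.
move=> us; rewrite rootE hornerD hornerN hornerZ subr_eq0 => /eqP e.
rewrite /notch_poly derivB derivZ hornerD hornerN hornerZ phase_derivE //.
rewrite (@horner_deriv_prod _ s) ?num_poly_neq0 //.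
have -> : (den_poly s)^`().[x%:C] =
    (den_poly s).[x%:C] * \sum_(z <- s) (x%:C - z^*)^-1.
  rewrite -(big_map conjc xpredT (fun z => (x%:C - z)^-1)).
  have eK : den_poly s = \prod_(z <- map conjc s) ('X - z%:P) by rewrite big_map.
  by rewrite eK horner_deriv_prod // -eK den_poly_neq0.
by rewrite mulrA -e -/(num_poly s) -mulrBr mulrC.
Qed.

Lemma notch_poly_top s w : (notch_poly s w)`_(size s) = 1 - w.
Proof. by rewrite coefB coefZ num_poly_top den_poly_top mulr1. Qed.

Lemma notch_poly1_top s : s != [::] ->
  (notch_poly s 1)`_(size s).-1 = - 'i%C * (total_phase s)%:C.
Proof.
move=> s0; rewrite coefB coefZ mul1r coefPn_prod_XsubC ?size_eq0 //.
have -> : (den_poly s)`_(size s).-1 = - \sum_(z <- s) z^*.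
  rewrite -(big_map conjc xpredT id) /= -(size_map conjc).
  rewrite -coefPn_prod_XsubC ?size_map ?size_eq0 //.
  by rewrite /den_poly big_map.
rewrite -opprD -sumrB rmorph_sum mulNr mulr_sumr; congr (- _).
by apply: eq_bigr => z _; rewrite subcJ rmorphM rmorph_nat /= mulrC.
Qed.

Lemma total_phase_gt0 s : s != [::] -> upper_half_plane s -> 0 < total_phase s.
Proof.
case: s => // z s _ /= /andP[z0 /allP us].
rewrite /total_phase big_cons ltr_pwDl ?mulr_gt0 // big_seq sumr_ge0 // => y /us.
by move=> y0; rewrite ltW // mulr_gt0.
Qed.

(** For [w = 1] the leading terms cancel, and the next coefficient is nonzero because the imaginary
    parts of the zeros add up to a positive number. The degree drops by exactly one; the lost root
    is the notch at infinity. *)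
Lemma size_notch_poly s w : s != [::] -> upper_half_plane s ->
  size (notch_poly s w) = if w == 1 then size s else (size s).+1.
Proof.
move=> s0 us.
have sz : (size (notch_poly s w) <= (size s).+1)%N.
  rewrite (leq_trans (size_polyD _ _)) // geq_max size_num_poly leqnn size_polyN.
  by rewrite (leq_trans (size_scale_leq _ _)) // size_den_poly.
have top k : (notch_poly s w)`_k != 0 -> (k < size (notch_poly s w))%N.
  by apply: contraNltn => /(nth_default 0) ->.
case: eqP => [w1|/eqP w1]; apply/eqP; rewrite eqn_leq.
  apply/andP; split.
    apply/leq_sizeP => j; rewrite leq_eqVlt => /predU1P[<-|].
      by rewrite notch_poly_top w1 subrr.
    by move=> jN; rewrite nth_default // (leq_trans sz).
  have : (notch_poly s w)`_(size s).-1 != 0.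
    rewrite w1 notch_poly1_top // mulf_neq0 //.
      by rewrite oppr_eq0 complexi_neq0.
    by rewrite fmorph_eq0 gt_eqF ?total_phase_gt0.
  by move=> /top; case: (s) s0.
by rewrite sz /= top // notch_poly_top subr_eq0 eq_sym.
Qed.

(** The roots are real, and simple because the derivative there is a product of ['i], the positive
    [phase_deriv] and a nonzero value of [num_poly s]. *)
Lemma notch_poly_factor s w : s != [::] -> upper_half_plane s -> `|w| = 1 ->
  exists2 rs : seq R, uniq rs & notch_poly s w =
    lead_coef (notch_poly s w) *: \prod_(x <- rs) ('X - x%:C%:P).
Proof.
move=> s0 us w1; set q := notch_poly s w.
have q0 : q != 0.
  by rewrite -size_poly_gt0 size_notch_poly //; case: ifP; case: (s) s0.
have [cs qE] := closed_field_poly_normal q.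
have lc0 : lead_coef q != 0 by rewrite lead_coef_eq0.
have realcs c : root q c -> c = (complex.Re c)%:C.
  by move=> /(root_notch_poly_real s0 us w1); case: c => a b /= ->.
have rootcs c : root q c = (c \in cs).
  by rewrite qE rootZ // root_prod_XsubC.
exists (map (@complex.Re R) cs); last first.
  rewrite [LHS]qE big_map; congr (_ *: _); apply: eq_big_seq => c.
  by rewrite -rootcs => /realcs <-.
have ucs : uniq cs.
  rewrite -separable_prod_XsubC -[X in separable_poly X](scalerK lc0) -qE.
  have sq : separable_poly q.
    rewrite unlock; apply: closed_coprimep => // c qc.
    have cE := realcs c qc; move: qc; rewrite cE => qc.
    rewrite rootE notch_poly_deriv //; apply/negP.
    apply: mulf_neq0; last exact: num_poly_neq0.
    apply: mulf_neq0; first exact: complexi_neq0.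
    by rewrite fmorph_eq0 gt_eqF // phase_deriv_gt0.
  have [c1 c2] := (invr_neq0 lc0, sq).
  by move: c2; rewrite !unlock derivZ coprimepZl // coprimepZr.
rewrite map_inj_in_uniq // => c d; rewrite -!rootcs => /realcs -> /realcs ->.
by move=> /= ->.
Qed.

End blaschke_product.

(** * Sums over the notches *)

Section notch_sums.
Variable R : realType.
Implicit Types (s : seq R[i]) (w : R[i]) (x : R).

Definition blaschke s x : R[i] := (num_poly s).[x%:C] / (den_poly s).[x%:C].

Lemma root_notch_polyE s w x : upper_half_plane s ->
  root (notch_poly s w) x%:C = (blaschke s x == w).
Proof.
move=> us; rewrite rootE hornerD hornerN hornerZ subr_eq0 /blaschke.
by rewrite -[RHS](inj_eq (mulIf (den_poly_neq0 x us))) divfK // den_poly_neq0.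
Qed.

(** Adding [None] exactly when [w = 1] compensates the drop in degree, so the count is the same for
    all [w]. This list yields the existence of the notches, and every other enumeration is a
    permutation of it. *)
Lemma notch_seqP s w : s != [::] -> upper_half_plane s -> `|w| = 1 ->
  exists2 rs : seq R,
    notch_poly s w =
      lead_coef (notch_poly s w) *: \prod_(x <- rs) ('X - x%:C%:P) &
    let ys := (if w == 1 then [:: None] else [::]) ++ map Some rs in
    [/\ uniq rs, size ys = size s, uniq ys &
      forall y, y \in ys <-> oapp (blaschke s) 1 y = w].
Proof.
move=> s0 us w1; have [rs urs qE] := notch_poly_factor s0 us w1.
exists rs => //=.
have q0 : notch_poly s w != 0.
  by rewrite -size_poly_gt0 size_notch_poly //; case: ifP; case: (s) s0.
have lc0 : lead_coef (notch_poly s w) != 0 by rewrite lead_coef_eq0.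
have szrs : (size rs).+1 = size (notch_poly s w).
  by rewrite qE size_scale // -(big_map (fun x : R => x%:C) xpredT
    (fun z => 'X - z%:P)) size_prod_XsubC size_map.
have uSrs : uniq (map Some rs) by rewrite map_inj_uniq // => x y [].
split=> //.
- rewrite size_cat size_map; move: szrs; rewrite size_notch_poly //.
  by case: ifP => _ /=; [rewrite add1n|case].
- rewrite cat_uniq uSrs andbT; apply/andP; split; first by case: ifP.
  by apply/hasPn => _ /mapP[x _ ->]; case: ifP.
move=> [x|] /=.
- rewrite mem_cat (_ : (Some x \in _) = false); last by case: ifP.
  rewrite /= mem_map; last by move=> a b [].
  rewrite (rwP eqP) -root_notch_polyE // qE rootZ //.
  rewrite -(big_map (fun x : R => x%:C) xpredT (fun z => 'X - z%:P)).
  by rewrite root_prod_XsubC mem_map //; exact: complexI.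
- rewrite mem_cat [X in _ || X](_ : _ = false) ?orbF; last by apply/mapP => -[].
  by rewrite [X in _ <-> X](rwP eqP) eq_sym; case: ifP.
Qed.

(* The summand at the infinite notch is the limit computed in
   [cvg_infty_quotient]. At a finite notch [num_poly s = w *: den_poly s], so the
   summand is ['i * (U + w *: V) / q^`()] with [q = notch_poly s w], and
   [sum_lagrange] applies. If [w = 1] then [q] and [U + V] both drop in degree and
   the infinite notch supplies the missing term. *)
Lemma notch_sum s w (A U V : {poly R[i]}) (ys : seq (option R)) :
  s != [::] -> upper_half_plane s -> `|w| = 1 ->
  (size U <= size s)%N -> (size V <= size s)%N ->
  A = U * den_poly s + V * num_poly s -> (size A < size s + size s)%N ->
  uniq ys -> (forall y, y \in ys <-> oapp (blaschke s) 1 y = w) ->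
  \sum_(y <- ys) oapp (fun x => rfrac A (num_poly s * den_poly s) x%:C /
                                 (phase_deriv s x)%:C)
                      (A`_(size s + size s).-2 / (total_phase s)%:C) y =
  'i%C * U`_(size s).-1.
Proof.
move=> s0 us w1 szU szV AE szA uys ysP.
have [rs qE [urs szys uys' ysP']] := notch_seqP s0 us w1.
set q := notch_poly s w in qE.
have q0 : q != 0.
  by rewrite -size_poly_gt0 size_notch_poly //; case: ifP; case: (s) s0.
have lc0 : lead_coef q != 0 by rewrite lead_coef_eq0.
set zs := map (fun x : R => x%:C) rs.
have qzs : q = lead_coef q *: \prod_(z <- zs) ('X - z%:P) by rewrite big_map.
have uzs : uniq zs by rewrite map_inj_uniq //; exact: complexI.
have szq : size q = (size zs).+1.
  by rewrite [in LHS]qzs size_scale // size_prod_XsubC.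
have fin_sum : (size (U + w *: V)%R <= size zs)%N ->
    \sum_(x <- rs) rfrac A (num_poly s * den_poly s) x%:C / (phase_deriv s x)%:C =
    'i%C / lead_coef q * (U + w *: V)`_(size zs).-1.
  move=> szp; rewrite -(sum_lagrange uzs szp) big_map mulr_sumr.
  apply: eq_big_seq => x xrs /=.
  have qx : root q x%:C.
    by rewrite qzs rootZ // root_prod_XsubC map_f.
  have := notch_poly_deriv us qx; rewrite -/q [in q^`()]qzs derivZ hornerZ.
  set D := (\prod_(z <- zs) _)^`().[_] => DE.
  have -> : D = 'i%C * (phase_deriv s x)%:C * (num_poly s).[x%:C] / lead_coef q.
    by rewrite -DE mulrC mulKf.
  move: qx; rewrite root_notch_polyE // => /eqP wE.
  have num0 := num_poly_neq0 x us; have den0 := den_poly_neq0 x us.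
  have i0 := complexi_neq0 R.
  have ph0 : (phase_deriv s x)%:C != 0.
    by rewrite fmorph_eq0 gt_eqF // phase_deriv_gt0.
  rewrite /rfrac AE -wE /blaschke !(hornerE, hornerM, hornerD, hornerZ).
  move: i0 ph0 num0 den0 lc0 => /=; move: (lead_coef q) 'i%C => l i i0 ph0 num0 den0 lc0.
  by field; rewrite ?i0 ?ph0 ?num0 ?den0 ?lc0.
have topA : (size s + size s).-1 = ((size s).-1 + size s)%N.
  by case: (s) s0.
(* This is the coefficient of degree [2 * size s - 1] in [A], which vanishes by the bound on its
   size. *)
have UV : U`_(size s).-1 + V`_(size s).-1 = 0.
  have : A`_((size s).-1 + size s) = 0.
    by rewrite -topA nth_default //; case: (s) s0 szA.
  rewrite AE coefD !coefM_top ?size_num_poly ?size_den_poly ?prednK //;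
    try by [rewrite lt0n size_eq0].
  by rewrite num_poly_top den_poly_top !mulr1.
have VU : V`_(size s).-1 = - U`_(size s).-1.
  by apply/eqP; rewrite -addr_eq0 addrC UV.
have pe : perm_eq ys ((if w == 1 then [:: None] else [::]) ++ map Some rs).
  by apply: uniq_perm => // y; apply/idP/idP => /[dup] ? ; [move/ysP/ysP'|move/ysP'/ysP].
rewrite (perm_big _ pe) big_cat big_map /=.
have szq' := size_notch_poly w s0 us; rewrite -/q szq in szq'.
case: eqP szq' => [wE|/eqP wN1] szq'.
- pose p := U + V; pose k := size zs.
  have szp : (size p <= k)%N.
    apply/leq_sizeP => j; rewrite leq_eqVlt => /predU1P[<-|].
      have -> : k = (size s).-1 by rewrite /k -szq'.
      by rewrite coefD UV.
    rewrite szq' => sj; rewrite nth_default //.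
    by rewrite (leq_trans (size_polyD _ _)) // geq_max (leq_trans szU) // (leq_trans szV).
  rewrite big_seq1 /= wE scale1r in fin_sum *; rewrite fin_sum // -/p -/k.
  (* In this form the top coefficient of [A] splits into the term found by [fin_sum] and a multiple
     of the wanted coefficient of [U]. *)
  have AE' : A = p * num_poly s - U * q.
    by rewrite AE /p /q wE /notch_poly scale1r; ring.
  have qk : lead_coef q = - 'i%C * (total_phase s)%:C.
    by rewrite lead_coefE szq szq' /q wE notch_poly1_top.
  have szUk : (size U <= k.+1)%N by rewrite szq'.
  (* If [k = 0] then [p = 0], so the truncated predecessor is harmless. *)
  have pk : (p * num_poly s)`_(k + k) = p`_k.-1.
    move: szq'; rewrite -/k; case: (k) szp => [|j] szp szs.
      by rewrite (size_poly_leq0P _ szp) mul0r !coef0.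
    rewrite addSnnS coefM_top ?size_num_poly -?szs //.
    by rewrite [in j.+2]szs num_poly_top mulr1.
  rewrite -szq' -/k /= addnS /= AE' coefB pk coefM_top ?szq //.
  have -> : q`_k = lead_coef q by rewrite lead_coefE szq.
  have t0 : (total_phase s)%:C != 0.
    by rewrite fmorph_eq0 gt_eqF // total_phase_gt0.
  have i0 := complexi_neq0 R.
  rewrite qk; move: (total_phase s)%:C t0 U`_k p`_k.-1 => t t0 u c.
  have -> : 'i%C / (- 'i%C * t) * c = - c / t by field; rewrite t0 i0.
  by field.
- rewrite big_nil add0r fin_sum; last first.
    case: szq' => ->; rewrite (leq_trans (size_polyD _ _)) // geq_max szU.
    by rewrite (leq_trans (size_scale_leq _ _)).
  case: szq' => szz.
  have -> : lead_coef q = 1 - w by rewrite lead_coefE szq szz /= notch_poly_top.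
  rewrite szz coefD coefZ VU.
  by field; rewrite subr_eq0 eq_sym.
Qed.

End notch_sums.

(** * Integrals *)

Section integral_sqrt.
Variable R : realType.
Let mu := @lebesgue_measure R.

Lemma cvgy_sqrt : Num.sqrt x @[x --> (+oo : set_system R)] --> (+oo : set_system R).
Proof.
apply/cvgryPge => M; near=> x.
have Mx : M ^+ 2 <= x by near: x; apply: nbhs_pinfty_ge; rewrite num_real.
rewrite (le_trans (ler_norm M)) // -sqrtr_sqr ler_wsqrtr //.
Unshelve. all: by end_near. Qed.

Lemma continuous_sqrt_comp_div (g : R -> R) x : continuous g -> 0 < x ->
  {for x, continuous (fun u => g (Num.sqrt u) / Num.sqrt u)}.
Proof.
move=> cg x0; apply: cvgM.
  by apply: (cvg_comp Num.sqrt g); [exact: sqrt_continuous|exact: cg].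
apply: cvgV; first by rewrite gt_eqF // sqrtr_gt0.
exact: sqrt_continuous.
Qed.

Lemma is_derive_sqrt_comp (g Psi : R -> R) (x : R) :
  (forall y : R, is_derive y 1 Psi (g y)) -> 0 < x ->
  is_derive x 1 (fun u => 2 * Psi (Num.sqrt u)) (g (Num.sqrt x) / Num.sqrt x).
Proof.
move=> dPsi x0; have s0 : Num.sqrt x != 0 by rewrite gt_eqF // sqrtr_gt0.
have d1 := is_derive1_comp (dPsi (Num.sqrt x)) (is_derive1_sqrt x0).
have := is_deriveZ 2 d1.
rewrite (_ : _ *: _ = g (Num.sqrt x) / Num.sqrt x) // /GRing.scale /=.
by field.
Qed.

Lemma measurable_sqrt_comp_div (g : R -> R) : continuous g ->
  measurable_fun (`]0%R, +oo[ : set R) (fun u => g (Num.sqrt u) / Num.sqrt u).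
Proof.
move=> cg; apply: open_continuous_measurable_fun => // x.
rewrite inE /= in_itv /= andbT => x0.
exact: continuous_sqrt_comp_div.
Qed.

(** The integrand may blow up at [0], where [2 * Psi (Num.sqrt u)] is only known to be continuous.
    The fundamental theorem is therefore applied on [[a, +oo[] with [a > 0], and monotone
    convergence along [a = 1 / (k + 1)] reaches the origin. *)
Lemma ge0_integral_sqrt_comp (g Psi : R -> R) (l : R) :
  (forall x : R, is_derive x 1 Psi (g x)) -> continuous g -> (forall x, 0 <= g x) ->
  Psi x @[x --> +oo] --> l ->
  (\int[mu]_(u in `[0%R, +oo[) (g (Num.sqrt u) / Num.sqrt u)%:E =
   (2 * (l - Psi 0))%:E)%E.
Proof.
move=> dPsi cg g0 Psil.
pose f u := g (Num.sqrt u) / Num.sqrt u.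
pose F u := 2 * Psi (Num.sqrt u).
have mf : measurable_fun (`]0%R, +oo[ : set R) f by exact: measurable_sqrt_comp_div.
have f0 x : 0 <= f x by rewrite divr_ge0 // sqrtr_ge0.
have Fl : F x @[x --> +oo] --> 2 * l.
  apply: cvgM; first exact: cvg_cst.
  exact: (cvg_comp Num.sqrt Psi cvgy_sqrt).
have cPsi : continuous Psi.
  by move=> x; apply/differentiable_continuous/derivable1_diffP; exact: ex_derive.
have cF : continuous F.
  move=> x; apply: cvgM; first exact: cvg_cst.
  by apply: (cvg_comp Num.sqrt Psi); [exact: sqrt_continuous|exact: cPsi].
have dF (x : R) : 0 < x -> is_derive x 1 F (f x).
  by move=> x0; exact: is_derive_sqrt_comp.
have int_a a : 0 < a ->
    (\int[mu]_(u in `[a, +oo[) (f u)%:E = (2 * l)%:E - (F a)%:E)%E.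
  move=> a0; apply: ge0_continuous_FTC2y => //.
  - apply/continuous_within_itvcyP; split.
      move=> x; rewrite in_itv /= andbT => ax.
      by apply: continuous_sqrt_comp_div => //; exact: lt_trans ax.
    by apply: cvg_at_right_filter; exact: continuous_sqrt_comp_div.
  - by move=> x ax; have [] := dF x (lt_trans a0 ax).
  - by apply: cvg_at_right_filter; exact: cF.
  - move=> x; rewrite in_itv /= andbT => ax.
    by rewrite derive1E; have [_ ->] := dF x (lt_trans a0 ax).
(* The endpoint [0], where the quotient takes the conventional value [0], is a null set. *)
rewrite -integral_itv_obnd_cbnd; last exact/measurable_EFinP.
rewrite itvoyEbigcup.
have := @ge0_nondecreasing_set_cvg_integral _ (measurableTypeR R) R
  (fun k => `[(0 + k.+1%:R^-1)%R, +oo[%classic : set R) (EFin \o f) mu.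
move=> /(_ _ _ _ _)/cvg_lim => <- //=.
- have -> : (fun k => \int[mu]_(u in `[(0 + k.+1%:R^-1)%R, +oo[) (f u)%:E)%E =
      (fun k => (2 * l - F (k.+1%:R^-1))%:E).
    by apply/funext => k; rewrite add0r int_a ?invr_gt0 // EFinB.
  apply/cvg_lim => //; apply: cvg_EFin; first exact: nearW.
  rewrite mulrBr; apply: cvgB; first exact: cvg_cst.
  rewrite -[X in Psi X](@sqrtr0 R) -/(F 0).
  apply: (cvg_comp _ F); [exact: cvg_harmonic|exact: cF].
- by move=> i j ij; apply/subsetPset/subset_itvr; rewrite bnd_simp !add0r lef_pV2 ?posrE ?ler_nat.
- move=> k; apply/measurable_EFinP; apply: measurable_funS mf => //.
  by apply: subset_itvr; rewrite bnd_simp ltr_wpDl ?invr_gt0.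
- by move=> k x _; rewrite lee_fin f0.
Qed.


Lemma measurable_sqrt_comp_divc (g : R -> R) : continuous g ->
  measurable_fun (`[0%R, +oo[ : set R)
    (fun u : R => g (Num.sqrt u) / Num.sqrt u).
Proof.
by move=> cg; apply/measurable_fun_itv_obnd_cbndP; exact: measurable_sqrt_comp_div.
Qed.

Lemma ge0_integrable_sqrt_comp (g Psi : R -> R) (l : R) :
  (forall x : R, is_derive x 1 Psi (g x)) -> continuous g ->
  (forall x, 0 <= g x) -> Psi x @[x --> +oo] --> l ->
  mu.-integrable `[0%R, +oo[ (fun u => (g (Num.sqrt u) / Num.sqrt u)%:E).
Proof.
move=> dPsi cg g0 Psil; apply/integrableP; split.
  by apply/measurable_EFinP; exact: measurable_sqrt_comp_divc.
under eq_integral => u _ do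
  rewrite gee0_abs ?lee_fin ?divr_ge0 ?sqrtr_ge0 ?g0 //.
by rewrite (ge0_integral_sqrt_comp dPsi cg g0 Psil) ltry.
Qed.

(** Adding the majorant [C / (1 + x ^+ 2)], whose primitive is [C * atan], makes the integrand
    nonnegative; its contribution is then subtracted. *)
Lemma integral_sqrt_comp (g Psi : R -> R) (l C : R) :
  (forall x : R, is_derive x 1 Psi (g x)) -> continuous g ->
  (forall x, `|g x| <= C / (1 + x ^+ 2)) -> Psi x @[x --> +oo] --> l ->
  mu.-integrable `[0%R, +oo[ (fun u => (g (Num.sqrt u) / Num.sqrt u)%:E) /\
  Rintegral mu `[0%R, +oo[ (fun u => g (Num.sqrt u) / Num.sqrt u) =
  2 * (l - Psi 0).
Proof.
move=> dPsi cg gC Psil.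
pose b x := C / (1 + x ^+ 2).
have b0 x : 0 <= b x by exact: le_trans (gC x).
have db (x : R) : is_derive x 1 (fun u => C * atan u) (b x).
  by have := is_deriveZ C (is_derive1_atan x).
have cb : continuous b.
  move=> x; apply: cvgM; first exact: cvg_cst.
  apply: cvgV; first by rewrite gt_eqF // ltr_pwDl // sqr_ge0.
  by apply: cvgD; [exact: cvg_cst|exact: exprn_continuous].
have lb : C * atan x @[x --> +oo] --> C * (pi / 2).
  by apply: cvgM; [exact: cvg_cst|exact: cvgy_atan].
pose g1 x := g x + b x.
pose Psi1 x := Psi x + C * atan x.
have dPsi1 (x : R) : is_derive x 1 Psi1 (g1 x) by exact: is_deriveD.
have cg1 : continuous g1 by move=> x; apply: cvgD; [exact: cg|exact: cb].
have g10 x : 0 <= g1 x by have := gC x; rewrite /g1 /b ler_norml; lra.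
have l1 : Psi1 x @[x --> +oo] --> l + C * (pi / 2) by exact: cvgD.
have i1 := ge0_integrable_sqrt_comp dPsi1 cg1 g10 l1.
have i2 := ge0_integrable_sqrt_comp db cb b0 lb.
have gE u : g (Num.sqrt u) / Num.sqrt u =
    g1 (Num.sqrt u) / Num.sqrt u - b (Num.sqrt u) / Num.sqrt u.
  by rewrite -mulrBl /g1 addrK.
split.
  by apply: eq_integrable (integrableB _ i1 i2) => // u _ /=; rewrite gE EFinB.
under eq_Rintegral => u _ do rewrite gE.
rewrite RintegralB // /Rintegral.
rewrite (ge0_integral_sqrt_comp dPsi1 cg1 g10 l1).
rewrite (ge0_integral_sqrt_comp db cb b0 lb) /= /Psi1.
ring.
Qed.

End integral_sqrt.

(** * Limits at the point at infinity *)

Section limits_at_infinity.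
Variable R : realType.

Instance infty_nbhs_proper : ProperFilter (infty_nbhs R).
Proof.
apply: Build_ProperFilter_ex.
  move=> A [M _ MA]; exists (`|M| + 1); apply: MA => /=.
  by rewrite [ltRHS]ger0_norm ?addr_ge0 // (le_lt_trans (ler_norm _)) // ltrDl.
apply: filter_from_filter; first by exists 0.
move=> M N _ _; exists (Num.max M N) => // x /=.
by rewrite gt_max => /andP[].
Qed.

Lemma cvgy_infty_nbhs : (+oo : set_system R) `=>` infty_nbhs R.
Proof.
move=> A [M _ MA]; near=> x; apply: MA => /=.
rewrite (lt_le_trans _ (ler_norm _)) //.
by near: x; apply: nbhs_pinfty_gt; rewrite num_real.
Unshelve. all: by end_near. Qed.

Lemma cvgNy_infty_nbhs : (-oo : set_system R) `=>` infty_nbhs R.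
Proof.
move=> A [M _ MA]; near=> x; apply: MA => /=.
rewrite -normrN (lt_le_trans _ (ler_norm _)) // ltrNr.
by near: x; apply: nbhs_ninfty_lt; rewrite num_real.
Unshelve. all: by end_near. Qed.

Lemma cvg_infty_invc : (fun x : R => (x%:C)^-1 : R[i]^o) @ infty_nbhs R --> (0 : R[i]^o).
Proof.
apply/cvgr0Pnorm_lt => -[e e'] /=; rewrite ltcE /= => /andP[/eqP -> e0].
exists e^-1 => // x /= xe.
have x0 : 0 < `|x| by rewrite (lt_trans _ xe) // invr_gt0.
rewrite normfV normc_def /= expr0n addr0 sqrtr_sqr -fmorphV /= ltcR.
by rewrite -[e]invrK ltf_pV2 ?posrE // invr_gt0.
Qed.

Lemma cvg_complex_Re {T} (F : set_system T) (FF : Filter F) (f : T -> R[i]) (l : R[i]) :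
  (f : T -> R[i]^o) @ F --> (l : R[i]^o) -> complex.Re (f x) @[x --> F] --> complex.Re l.
Proof.
move=> /cvgrPdist_lt fl; apply/cvgrPdist_lt => e e0.
have e0' : 0 < (e%:C : R[i]^o) by rewrite ltcR.
apply: filterS (fl _ e0') => x /=; rewrite -ltcR; apply: le_lt_trans.
by rewrite -raddfB; exact: normc_ge_Re.
Qed.

Lemma cvg_complex_Im {T} (F : set_system T) (FF : Filter F) (f : T -> R[i]) (l : R[i]) :
  (f : T -> R[i]^o) @ F --> (l : R[i]^o) -> complex.Im (f x) @[x --> F] --> complex.Im l.
Proof.
move=> fl; have ImE (z : R[i]) : complex.Im z = complex.Re (- 'i%C * z).
  by case: z => a b; rewrite mulNr raddfN /= mul0r mul1r sub0r opprK.
under eq_fun => x do rewrite ImE.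
rewrite ImE; apply: cvg_complex_Re.
by apply: (@cvgM R[i]); [exact: cvg_cst|].
Qed.

Lemma cvg_exprS0 {T} (F : set_system T) (FF : Filter F) (f : T -> R[i]) k :
  (f : T -> R[i]^o) @ F --> (0 : R[i]^o) ->
  ((fun x => f x ^+ k.+1) : T -> R[i]^o) @ F --> (0 : R[i]^o).
Proof.
move=> f0; elim: k => [|k IH]; first exact: f0.
rewrite -[X in _ --> X](mulr0 (0 : R[i]^o)).
by under eq_fun => x do rewrite exprS; exact: (@cvgM R[i]).
Qed.

Lemma cvg_infty_div (z : R[i]) :
  (fun x : R => x%:C / (x%:C - z) : R[i]^o) @ infty_nbhs R --> (1 : R[i]^o).
Proof.
have h : (fun x : R => (1 - z * (x%:C)^-1)^-1 : R[i]^o) @ infty_nbhs R --> (1 : R[i]^o).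
  rewrite -[X in _ --> X]invr1; apply: cvgV; first exact: oner_neq0.
  rewrite -[X in _ --> X](subr0 (1 : R[i]^o)) -(mulr0 z).
  apply: (@cvgB R[i] R[i]^o); first exact: cvg_cst.
  by apply: (@cvgM R[i]); [exact: cvg_cst|exact: cvg_infty_invc].
apply: cvg_trans h; apply: near_eq_cvg; exists 0 => // x /= x0.
have xC0 : x%:C != 0 :> R[i] by rewrite fmorph_eq0 -normr_gt0.
have -> : 1 - z * (x%:C)^-1 = (x%:C - z) / x%:C by field.
by rewrite invf_div.
Qed.

Lemma cvg_infty_inv_sub (z : R[i]) :
  (fun x : R => (x%:C - z)^-1 : R[i]^o) @ infty_nbhs R --> (0 : R[i]^o).
Proof.
have h : (fun x : R => x%:C / (x%:C - z) * (x%:C)^-1 : R[i]^o) @ infty_nbhs R --> (0 : R[i]^o).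
  rewrite -[X in _ --> X](mulr0 (1 : R[i]^o)).
  by apply: (@cvgM R[i]); [exact: cvg_infty_div|exact: cvg_infty_invc].
apply: cvg_trans h; apply: near_eq_cvg; exists 0 => // x /= x0.
have xC0 : x%:C != 0 :> R[i] by rewrite fmorph_eq0 -normr_gt0.
by rewrite mulrAC divff // mul1r.
Qed.

Lemma cvg_infty_poly (p : {poly R[i]}) (d : nat) : (size p <= d.+1)%N ->
  (fun x : R => p.[x%:C] / x%:C ^+ d : R[i]^o) @ infty_nbhs R --> (p`_d : R[i]^o).
Proof.
elim/poly_ind: p d => [|p c IH] d szp.
  have h : (fun _ : R => 0 : R[i]^o) @ infty_nbhs R --> (0 : R[i]^o) by exact: cvg_cst.
  rewrite coef0; apply: cvg_trans h; apply: near_eq_cvg.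
  by apply: nearW => x; rewrite horner0 mul0r.
case: d szp => [|d] szp.
  have /size1_polyC -> := szp; set a := _`_0; rewrite coefC /=.
  have h : (fun _ : R => a : R[i]^o) @ infty_nbhs R --> (a : R[i]^o) by exact: cvg_cst.
  apply: cvg_trans h; apply: near_eq_cvg.
  by apply: nearW => x; rewrite hornerC expr0 divr1.
have szp' : (size p <= d.+1)%N.
  by move: szp; rewrite size_MXaddC; case: ifP => // /andP[/eqP -> _]; rewrite size_poly0.
have h : (fun x : R => p.[x%:C] / x%:C ^+ d + c * (x%:C)^-1 ^+ d.+1 : R[i]^o) @ infty_nbhs R -->
    (p`_d + c * 0 : R[i]^o).
  apply: (@cvgD R[i] R[i]^o); first exact: IH.
  apply: (@cvgM R[i]); first exact: cvg_cst.
  exact: cvg_exprS0 cvg_infty_invc.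
rewrite mulr0 addr0 in h.
rewrite coefD coefMX coefC /= addr0.
apply: cvg_trans h; apply: near_eq_cvg; exists 0 => // x /= x0.
have xC0 : x%:C != 0 :> R[i] by rewrite fmorph_eq0 -normr_gt0.
rewrite hornerMXaddC mulrDl exprVn; congr (_ + _).
by rewrite exprS; field; rewrite expf_neq0 // xC0.
Qed.

End limits_at_infinity.

(** * Integrals over the line by primitives *)

Section line_integrals.
Variable R : realType.
Implicit Types (g : R -> R) (h : R -> R[i]) (z : R[i]).

(* [d] is the integral of [g] over the whole line. *)
Definition has_line_integral g (d : R) : Prop :=
  [/\ continuous g,
      exists C, forall x, `|g x| <= C / (1 + x ^+ 2) &
      exists Psi : R -> R, exists lp lm, [/\ forall x : R, is_derive x 1 Psi (g x),
        Psi x @[x --> +oo] --> lp, Psi x @[x --> -oo] --> lm & d = lp - lm]].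

Lemma has_line_integralD g1 g2 d1 d2 :
  has_line_integral g1 d1 -> has_line_integral g2 d2 ->
  has_line_integral (fun x => g1 x + g2 x) (d1 + d2).
Proof.
move=> [c1 [C1 b1] [P1 [p1 [m1 [D1 lp1 lm1 ->]]]]].
move=> [c2 [C2 b2] [P2 [p2 [m2 [D2 lp2 lm2 ->]]]]].
split.
- by move=> x; apply: cvgD; [exact: c1|exact: c2].
- exists (C1 + C2) => x; rewrite mulrDl (le_trans (ler_normD _ _)) //.
  exact: lerD.
- exists (fun x => P1 x + P2 x), (p1 + p2), (m1 + m2); split.
  + by move=> x; exact: is_deriveD.
  + exact: cvgD.
  + exact: cvgD.
  + by ring.
Qed.

Lemma has_line_integralZ g d c : has_line_integral g d ->
  has_line_integral (fun x => c * g x) (c * d).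
Proof.
move=> [cg [C b] [P [p [m [D lp lm ->]]]]]; split.
- by move=> x; apply: cvgM; [exact: cvg_cst|exact: cg].
- by exists (`|c| * C) => x; rewrite normrM -mulrA ler_wpM2l.
- exists (fun x => c * P x), (c * p), (c * m); split.
  + by move=> x; exact: is_deriveZ.
  + by apply: cvgM; [exact: cvg_cst|].
  + by apply: cvgM; [exact: cvg_cst|].
  + by ring.
Qed.

Lemma has_line_integral_atan : has_line_integral (fun x => (1 + x ^+ 2)^-1) pi.
Proof.
split.
- move=> x; apply: cvgV; first by rewrite gt_eqF // ltr_pwDl // sqr_ge0.
  by apply: cvgD; [exact: cvg_cst|exact: exprn_continuous].
- by exists 1 => x; rewrite mul1r ger0_norm // invr_ge0 addr_ge0 // sqr_ge0.
- exists (@atan R), (pi / 2), (- (pi / 2)); split.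
  + exact: is_derive1_atan.
  + exact: cvgy_atan.
  + apply/cvgNy_compNP; under eq_fun => x do rewrite /= atanN.
    by apply: cvgN; exact: cvgy_atan.
  + by lra.
Qed.

Definition has_line_integralC h (d : R[i]) : Prop :=
  has_line_integral (fun x => complex.Re (h x)) (complex.Re d) /\
  has_line_integral (fun x => complex.Im (h x)) (complex.Im d).

Lemma has_line_integralCD h1 h2 d1 d2 :
  has_line_integralC h1 d1 -> has_line_integralC h2 d2 ->
  has_line_integralC (fun x => h1 x + h2 x) (d1 + d2).
Proof.
move=> [r1 i1] [r2 i2]; split; rewrite raddfD.
- by under eq_fun => x do rewrite raddfD; exact: has_line_integralD.
- by under eq_fun => x do rewrite raddfD; exact: has_line_integralD.
Qed.

Lemma has_line_integralCZ h d c : has_line_integralC h d ->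
  has_line_integralC (fun x => c * h x) (c * d).
Proof.
case: c => a b [r i]; split.
- have -> : complex.Re ((a +i* b) * d) = a * complex.Re d + - b * complex.Im d.
    by case: d {r i} => u v /=; rewrite mulNr.
  have -> : (fun x => complex.Re ((a +i* b) * h x)) =
      (fun x => a * complex.Re (h x) + - b * complex.Im (h x)).
    by apply/funext => x; case: (h x) => u v /=; rewrite mulNr.
  by apply: has_line_integralD; exact: has_line_integralZ.
- have -> : complex.Im ((a +i* b) * d) = a * complex.Im d + b * complex.Re d.
    by case: d {r i} => u v /=.
  have -> : (fun x => complex.Im ((a +i* b) * h x)) =
      (fun x => a * complex.Im (h x) + b * complex.Re (h x)).
    by apply/funext => x; case: (h x) => u v /=.
  by apply: has_line_integralD; exact: has_line_integralZ.
Qed.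

Lemma has_line_integralC_conj h d : has_line_integralC h d ->
  has_line_integralC (fun x => (h x)^*) (d^*).
Proof.
move=> [r i]; split.
  have -> : (fun x => complex.Re ((h x)^*)) = (fun x => complex.Re (h x)).
    by apply/funext => x; case: (h x).
  by case: (d) r.
have -> : complex.Im (d^*) = -1 * complex.Im d by case: (d) => u v /=; rewrite mulN1r.
have -> : (fun x => complex.Im ((h x)^*)) = (fun x => -1 * complex.Im (h x)).
  by apply/funext => x; case: (h x) => u v /=; rewrite mulN1r.
exact: has_line_integralZ.
Qed.

(** Stated by components, so that primitives are available for the real and imaginary integrals
    separately. *)
Definition has_cderiv h h' := forall x : R,
  is_derive x 1 (fun u => complex.Re (h u)) (complex.Re (h' x)) /\
  is_derive x 1 (fun u => complex.Im (h u)) (complex.Im (h' x)).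

Lemma has_cderivM h1 h1' h2 h2' : has_cderiv h1 h1' -> has_cderiv h2 h2' ->
  has_cderiv (fun x => h1 x * h2 x) (fun x => h1' x * h2 x + h1 x * h2' x).
Proof.
move=> D1 D2 x; have [r1 i1] := D1 x; have [r2 i2] := D2 x; split.
- have -> : (fun u => complex.Re (h1 u * h2 u)) =
      (fun u => complex.Re (h1 u) * complex.Re (h2 u) - complex.Im (h1 u) * complex.Im (h2 u)).
    by apply/funext => u; case: (h1 u); case: (h2 u).
  apply: is_derive_eq (is_deriveB (is_deriveM r1 r2) (is_deriveM i1 i2)) _.
  rewrite raddfD /= /GRing.scale /=.
  case: (h1 x) (h2 x) (h1' x) (h2' x) => a1 b1 [a2 b2] [a3 b3] [a4 b4] /=; ring.
- have -> : (fun u => complex.Im (h1 u * h2 u)) =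
      (fun u => complex.Re (h1 u) * complex.Im (h2 u) + complex.Im (h1 u) * complex.Re (h2 u)).
    by apply/funext => u; case: (h1 u); case: (h2 u).
  apply: is_derive_eq (is_deriveD (is_deriveM r1 i2) (is_deriveM i1 r2)) _.
  rewrite raddfD /= /GRing.scale /=.
  case: (h1 x) (h2 x) (h1' x) (h2' x) => a1 b1 [a2 b2] [a3 b3] [a4 b4] /=; ring.
Qed.

Lemma has_cderiv_continuous h h' : has_cderiv h h' ->
  continuous (fun x => complex.Re (h x)) /\ continuous (fun x => complex.Im (h x)).
Proof.
move=> D; split=> x; have [[r _] [i _]] := D x;
  exact/differentiable_continuous/derivable1_diffP.
Qed.

Definition pole z (x : R) : R[i] := (x%:C - z)^-1.

Lemma poleE (a b : R) (u : R) : pole (a +i* b) u =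
  ((u - a) / ((u - a) ^+ 2 + b ^+ 2)) +i* (b / ((u - a) ^+ 2 + b ^+ 2)).
Proof. by rewrite /pole /GRing.inv /= sub0r sqrrN mulNr opprK. Qed.

Lemma has_cderiv_pole z : complex.Im z != 0 ->
  has_cderiv (pole z) (fun x => - pole z x ^+ 2).
Proof.
case: z => a b /= b0 x.
have n0 (u : R) : (u - a) ^+ 2 + b ^+ 2 != 0.
  by rewrite gt_eqF // ltr_wpDl ?sqr_ge0 // exprn_even_gt0.
have dn : is_derive x 1 (fun u : R => (u - a) ^+ 2 + b ^+ 2) (2 * (x - a)).
  by apply: is_derive_eq; rewrite /GRing.scale /=; ring.
have dV := @is_deriveV R (fun u : R => (u - a) ^+ 2 + b ^+ 2) x _ 1 (n0 x) dn.
have dx : is_derive x 1 (fun u : R => u - a) 1.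
  by apply: is_derive_eq; rewrite subr0.
have reE (c d : R) : complex.Re (- (c +i* d) ^+ 2) = - (c * c - d * d) by [].
have imE (c d : R) : complex.Im (- (c +i* d) ^+ 2) = - (c * d + d * c) by [].
split; rewrite poleE ?reE ?imE; under eq_fun => u do rewrite poleE /=.
- apply: is_derive_eq (is_deriveM dx dV) _.
  by rewrite /GRing.scale /=; field; exact: n0.
- apply: is_derive_eq (is_deriveZ b dV) _.
  by rewrite /GRing.scale /=; field; exact: n0.
Qed.

Lemma has_cderiv_eq h h1 h2 : has_cderiv h h1 -> h1 =1 h2 -> has_cderiv h h2.
Proof. by move=> D e x; rewrite -e; exact: D. Qed.

Lemma has_cderiv_poleX z k : complex.Im z != 0 ->
  has_cderiv (fun x => pole z x ^+ k.+1) (fun x => - k.+1%:R * pole z x ^+ k.+2).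
Proof.
move=> z0; elim: k => [|k IH].
  by apply: has_cderiv_eq (has_cderiv_pole z0) _ => x; rewrite mulN1r.
have := has_cderivM (has_cderiv_pole z0) IH.
under eq_fun => x do rewrite -exprS.
move=> /has_cderiv_eq; apply=> x.
by rewrite -(natr1 k.+1) !exprS; ring.
Qed.

Lemma has_cderivZ h h' c : has_cderiv h h' ->
  has_cderiv (fun x => c * h x) (fun x => c * h' x).
Proof.
move=> D.
have D0 : has_cderiv (fun _ => c) (fun _ => 0) by move=> x; split; exact: is_derive_cst.
by apply: has_cderiv_eq (has_cderivM D0 D) _ => x; rewrite mul0r add0r.
Qed.

Lemma ler_normr_Re z : `|complex.Re z| <= Normc.normc z.
Proof. by rewrite -lecR; exact: normc_ge_Re. Qed.

Lemma ler_normr_Im z : `|complex.Im z| <= Normc.normc z.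
Proof.
by case: z => a b /=; rewrite -sqrtr_sqr ler_wsqrtr // lerDr sqr_ge0.
Qed.

(** Convergence along [infty_nbhs] means one common limit at both ends, so the increment of the
    primitive is zero. *)
Lemma has_line_integralC_primitive h H l C : has_cderiv H h ->
  (H : R -> R[i]^o) @ infty_nbhs R --> (l : R[i]^o) ->
  continuous (fun x => complex.Re (h x)) -> continuous (fun x => complex.Im (h x)) ->
  (forall x, Normc.normc (h x) <= C / (1 + x ^+ 2)) -> has_line_integralC h 0.
Proof.
move=> D Hl cr ci hC.
have Fy := infty_nbhs_proper R.
split; split => //.
- by exists C => x; rewrite (le_trans (ler_normr_Re _)).
- exists (fun x => complex.Re (H x)), (complex.Re l), (complex.Re l); split.
  + by move=> x; have [] := D x.
  + exact: cvg_trans (cvg_app _ (@cvgy_infty_nbhs R)) (cvg_complex_Re _ Hl).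
  + exact: cvg_trans (cvg_app _ (@cvgNy_infty_nbhs R)) (cvg_complex_Re _ Hl).
  + by rewrite subrr.
- by exists C => x; rewrite (le_trans (ler_normr_Im _)).
- exists (fun x => complex.Im (H x)), (complex.Im l), (complex.Im l); split.
  + by move=> x; have [] := D x.
  + exact: cvg_trans (cvg_app _ (@cvgy_infty_nbhs R)) (cvg_complex_Im _ Hl).
  + exact: cvg_trans (cvg_app _ (@cvgNy_infty_nbhs R)) (cvg_complex_Im _ Hl).
  + by rewrite subrr.
Qed.

Lemma normc_pole z x : Normc.normc (pole z x) = (Normc.normc (x%:C - z))^-1.
Proof. exact: Normc.normcV. Qed.

Lemma pole_bound z : complex.Im z != 0 -> exists2 M, 0 <= M &
  forall x, Normc.normc (pole z x) ^+ 2 <= M / (1 + x ^+ 2).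
Proof.
case: z => a b; rewrite [complex.Im _]/= => b0; have b2 : 0 < b ^+ 2 by rewrite exprn_even_gt0.
have a2 : 0 <= a ^+ 2 by exact: sqr_ge0.
exists ((1 + a ^+ 2 + b ^+ 2) / b ^+ 2).
  by apply: divr_ge0; [rewrite !addr_ge0 // ltW|exact: ltW].
move=> x; rewrite normc_pole exprVn sqr_sqrtr ?addr_ge0 ?sqr_ge0 //= sub0r sqrrN.
have x1 : 0 < 1 + x ^+ 2 by rewrite ltr_pwDl // sqr_ge0.
rewrite ler_pdivlMr // mulrC ler_pdivrMr; last by rewrite ltr_wpDl // sqr_ge0.
rewrite mulrAC ler_pdivlMr //.
(* With [t = x - a], the difference of the two sides is exactly [t^2 + (a t - b^2)^2]; this is where
   the constant comes from. *)
have := sqr_ge0 (x - a); have := sqr_ge0 (a * (x - a) - b ^+ 2); nra.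
Qed.

Lemma pole_mul_bound z1 z2 : complex.Im z1 != 0 -> complex.Im z2 != 0 ->
  exists M, forall x, Normc.normc (pole z1 x * pole z2 x) <= M / (1 + x ^+ 2).
Proof.
move=> /pole_bound[M1 _ h1] /pole_bound[M2 _ h2]; exists (M1 + M2) => x.
rewrite Normc.normcM mulrDl (le_trans _ (lerD (h1 x) (h2 x))) //.
have n0 (z : R[i]) : 0 <= Normc.normc z by case: z => a b; exact: sqrtr_ge0.
have := n0 (pole z1 x); have := n0 (pole z2 x).
by have := sqr_ge0 (Normc.normc (pole z1 x) - Normc.normc (pole z2 x)); nra.
Qed.

Lemma poleX_bound z k : complex.Im z != 0 ->
  exists M, forall x, Normc.normc (pole z x ^+ k.+2) <= M / (1 + x ^+ 2).
Proof.
move=> z0; have [M M0 hM] := pole_bound z0.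
have n0 (w : R[i]) : 0 <= Normc.normc w by case: w => a b; exact: sqrtr_ge0.
have nB x : Normc.normc (pole z x) <= M + 1.
  have : Normc.normc (pole z x) ^+ 2 <= M.
    by rewrite (le_trans (hM x)) // ler_pdivrMr ?ltr_pwDl ?sqr_ge0 // ler_peMr // lerDl sqr_ge0.
  have := n0 (pole z x); nra.
elim: k => [|k [N hN]].
  by exists M => x; rewrite expr2 Normc.normcM -expr2.
exists ((M + 1) * N) => x; rewrite exprS Normc.normcM -mulrA.
by rewrite ler_pM.
Qed.

Lemma has_line_integralC_poleX z k : complex.Im z != 0 ->
  has_line_integralC (fun x => pole z x ^+ k.+2) 0.
Proof.
move=> z0; have [M hM] := poleX_bound k z0.
have [cr ci] := has_cderiv_continuous (has_cderiv_poleX k.+1 z0).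
have k0 : - k.+1%:R != 0 :> R[i] by rewrite oppr_eq0 pnatr_eq0.
have := has_cderivZ (- k.+1%:R)^-1 (has_cderiv_poleX k z0).
move=> /has_cderiv_eq/(_ (fun x => mulKf k0 _)) D.
apply: (has_line_integralC_primitive D _ cr ci hM).
  have Fy := infty_nbhs_proper R.
  apply: (@cvgM R[i]); first exact: cvg_cst.
  by apply: cvg_exprS0; exact: cvg_infty_inv_sub.
Qed.

Lemma cvg_infty_sqr_div_norm z :
  x ^+ 2 / Normc.normc (x%:C - z) ^+ 2 @[x --> infty_nbhs R] --> (1 : R).
Proof.
have Fy := infty_nbhs_proper R.
have h : (fun x : R => x%:C / (x%:C - z) * (x%:C / (x%:C - z^*)) : R[i]^o)
    @ infty_nbhs R --> (1 * 1 : R[i]^o).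
  by apply: (@cvgM R[i]); exact: cvg_infty_div.
have := cvg_complex_Re _ h; rewrite mulr1 /=.
under eq_fun => x.
  rewrite mulrACA -invfM subc_norm -rmorphM -fmorph_div /= -expr2.
  over.
exact.
Qed.

End line_integrals.

(** * Partial fractions with poles in the upper half plane *)

Section partial_fractions.
Variable R : realType.
Implicit Types (z : R[i]) (s : seq R[i]).

Lemma cvg_atan_affine (a b : R) : 0 < b ->
  atan ((x - a) / b) @[x --> +oo] --> pi / 2 /\
  atan ((x - a) / b) @[x --> -oo] --> - (pi / 2 : R).
Proof.
move=> b0.
have hy (c : R) : (x - c) / b @[x --> (+oo : set_system R)] --> (+oo : set_system R).
  apply/cvgryPge => M; near=> x.
  rewrite ler_pdivlMr // lerBrDr.
  by near: x; apply: nbhs_pinfty_ge; rewrite num_real.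
split; first exact: (cvg_comp _ (@atan R) (hy a) (@cvgy_atan R)).
apply/cvgNy_compNP.
have -> : (fun x => atan ((x - a) / b)) \o -%R = (fun x => - atan ((x - - a) / b)).
  by apply/funext => x /=; rewrite -atanN; congr (atan _); ring.
by apply: cvgN; exact: (cvg_comp _ (@atan R) (hy (- a)) (@cvgy_atan R)).
Unshelve. all: by end_near. Qed.

(** Up to a constant, the primitive is the continuous branch of [log (x - z)] along the line, for
    [z = a + i b]. *)
Lemma has_cderiv_log_pole (a b : R) : 0 < b ->
  has_cderiv (fun x => (2^-1 * ln ((x - a) ^+ 2 + b ^+ 2)) +i* atan ((x - a) / b))
    (pole (a +i* b)).
Proof.
move=> b0 x; have n0 : 0 < (x - a) ^+ 2 + b ^+ 2.
  by rewrite ltr_wpDl ?sqr_ge0 // exprn_gt0.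
have dn : is_derive x 1 (fun u : R => (u - a) ^+ 2 + b ^+ 2) (2 * (x - a)).
  by apply: is_derive_eq; rewrite /GRing.scale /=; ring.
have dx : is_derive x 1 (fun u : R => (u - a) / b) b^-1.
  by apply: is_derive_eq; rewrite /GRing.scale /=; ring.
rewrite poleE /=; split.
- have d := @is_derive1_comp R (@ln R) (fun u : R => (u - a) ^+ 2 + b ^+ 2) x _ _
    (is_derive1_ln n0) dn.
  apply: is_derive_eq (is_deriveZ 2^-1 d) _.
  by rewrite /GRing.scale /=; field; rewrite gt_eqF.
- apply: is_derive_eq (@is_derive1_comp R (@atan R) (fun u : R => (u - a) / b) x _ _
    (is_derive1_atan _) dx) _.
  by field; rewrite !gt_eqF // ltr_wpDl ?sqr_ge0 // exprn_gt0.
Qed.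

Lemma has_line_integralC_eq (h1 h2 : R -> R[i]) d : h1 =1 h2 ->
  has_line_integralC h1 d -> has_line_integralC h2 d.
Proof. by move=> /funext ->. Qed.

(* Subtracting [pole 'i] cancels the logarithmic growth of the primitive, and both
   poles lie in the same half plane, so the arctangents cancel too. *)
Lemma has_line_integralC_pole_diff z : 0 < complex.Im z ->
  has_line_integralC (fun x => pole z x - pole 'i%C x) 0.
Proof.
move=> z0; have zi : complex.Im z != 0 by rewrite gt_eqF.
have i0 : complex.Im 'i%C != 0 :> R by rewrite oner_eq0.
have [crz ciz] := has_cderiv_continuous (has_cderiv_pole zi).
have [cri cii] := has_cderiv_continuous (has_cderiv_pole i0).
have [M hM] := pole_mul_bound zi i0.
have hB x : Normc.normc (pole z x - pole 'i%C x) <=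
    Normc.normc (z - 'i%C) * M / (1 + x ^+ 2).
  have -> : pole z x - pole 'i%C x = (z - 'i%C) * (pole z x * pole 'i%C x).
    rewrite /pole; have := Im_neq0_sub x zi; have := Im_neq0_sub x i0.
    move: 'i%C => i nz ni; field; rewrite nz ni //.
  rewrite Normc.normcM -mulrA ler_wpM2l //; by case: (z - _) => ? ?; exact: sqrtr_ge0.
case: z z0 zi crz ciz hM hB => a b b0 zi crz ciz hM hB; rewrite /= in b0.
have D1 := @has_cderiv_log_pole a b b0.
have D2 := @has_cderiv_log_pole 0 1 ltr01.
have Fy := infty_nbhs_proper R.
split; split.
- under eq_fun => x do rewrite raddfB.
  by move=> x; apply: cvgB; [exact: crz|exact: cri].
- by eexists => x; apply: le_trans (hB x); exact: ler_normr_Re.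
- exists (fun x => 2^-1 * ln ((x - a) ^+ 2 + b ^+ 2) - 2^-1 * ln ((x - 0) ^+ 2 + 1 ^+ 2)), 0, 0.
  have lim0 : 2^-1 * ln ((x - a) ^+ 2 + b ^+ 2) - 2^-1 * ln ((x - 0) ^+ 2 + 1 ^+ 2)
      @[x --> infty_nbhs R] --> (0 : R).
    have nE (c d u : R) : Normc.normc (u%:C - (c +i* d)) ^+ 2 = (u - c) ^+ 2 + d ^+ 2.
      by rewrite sqr_normc_coords /= sub0r sqrrN.
    have n0 (c d u : R) : 0 < d -> 0 < (u - c) ^+ 2 + d ^+ 2.
      by move=> d0; rewrite ltr_wpDl ?sqr_ge0 // exprn_gt0.
    have lr (c d : R) : x ^+ 2 / ((x - c) ^+ 2 + d ^+ 2) @[x --> infty_nbhs R] --> (1 : R).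
      by have := cvg_infty_sqr_div_norm (c +i* d); under eq_fun => x do rewrite nE.
    have ra := lr a b; have ri := lr 0 1.
    (* The difference of logarithms is the logarithm of a ratio of quadratics; dividing [x ^+ 2] by
       each of them gives two quotients with limit [1]. *)
    pose q x := x ^+ 2 / ((x - 0) ^+ 2 + 1 ^+ 2) / (x ^+ 2 / ((x - a) ^+ 2 + b ^+ 2)).
    have r1 : q x @[x --> infty_nbhs R] --> (1 : R).
      rewrite -[X in _ --> X]divr1; apply: cvgM => //.
      by apply: cvgV => //; exact: oner_neq0.
    have l1 : ln (q x) @[x --> infty_nbhs R] --> (0 : R).
      by rewrite -(@ln1 R); exact: (cvg_comp q (@ln R) r1 (continuous_ln ltr01)).
    have l2 : 2^-1 * ln (q x) @[x --> infty_nbhs R] --> (0 : R).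
      rewrite -[X in _ --> X](mulr0 (2^-1 : R)).
      by apply: cvgM => //; exact: cvg_cst.
    apply: cvg_trans l2; apply: near_eq_cvg; exists 0 => // x /= x0.
    have xx : x != 0 by rewrite -normr_gt0.
    rewrite -mulrBr -ln_div ?posrE ?n0 //; rewrite /q; congr (_ * ln _).
    have na := lt0r_neq0 (n0 a b x b0).
    have ni : x ^+ 2 + 1 != 0.
      by have := n0 0 1 x ltr01; rewrite subr0 expr1n => /lt0r_neq0.
    by field; rewrite ni na xx.
  split.
  + move=> x; rewrite raddfB; have [d1 _] := D1 x; have [d2 _] := D2 x.
    exact: is_deriveB.
  + exact: cvg_trans (cvg_app _ (@cvgy_infty_nbhs R)) lim0.
  + exact: cvg_trans (cvg_app _ (@cvgNy_infty_nbhs R)) lim0.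
  + by rewrite subrr.
- under eq_fun => x do rewrite raddfB.
  by move=> x; apply: cvgB; [exact: ciz|exact: cii].
- by eexists => x; apply: le_trans (hB x); exact: ler_normr_Im.
- exists (fun x => atan ((x - a) / b) - atan ((x - 0) / 1)), (pi / 2 - pi / 2),
    (- (pi / 2) - - (pi / 2)).
  have [ay aNy] := cvg_atan_affine a b0.
  have [iy iNy] := cvg_atan_affine 0 (@ltr01 R).
  split.
  + move=> x; rewrite raddfB; have [_ d1] := D1 x; have [_ d2] := D2 x.
    exact: is_deriveB.
  + exact: cvgB.
  + exact: cvgB.
  + by rewrite /= !subrr.
Qed.

(** If all zeros coincide, the function is a power of one pole, with an explicit primitive.
    Otherwise two distinct zeros are separated by [1 / ((x - z) (x - y)) = (1 / (x - z) - 1 / (x -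
    y)) / (z - y)], which shortens the list without any bookkeeping of multiplicities. Only a single
    simple pole decays too slowly, hence the correction when [size s = 1]. *)
Lemma inv_num_poly_line_integral s : s != [::] -> upper_half_plane s ->
  has_line_integralC
    (fun x => (num_poly s).[x%:C]^-1 - (size s == 1%N)%:R * pole 'i%C x) 0.
Proof.
have [n] := ubnP (size s); elim: n s => // n IH [|z s] //; rewrite ltnS => szn _ us.
have numE t x : (num_poly t).[x%:C]^-1 = \prod_(y <- t) pole y x.
  by rewrite horner_num_poly prodfV.
have [allz|] := boolP (all (pred1 z) s).
  have /andP[z0 _] := us.
  have e (x : R) : (num_poly (z :: s)).[x%:C]^-1 = pole z x ^+ (size s).+1.
    rewrite numE big_cons exprS; congr (_ * _).
    by rewrite (all_pred1P _ _ allz) big_nseq size_nseq iter_mulr_1.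
  case: (s) e => [|y t] e.
    by apply: has_line_integralC_eq (has_line_integralC_pole_diff z0) => x /=;
      rewrite mul1r e.
  apply: has_line_integralC_eq (has_line_integralC_poleX (size t) _) => [x|].
    by rewrite e /= mul0r subr0.
  by rewrite gt_eqF.
case/allPn => y ys /= yz.
pose t := rem y s.
have st : perm_eq s (y :: t) by exact: perm_to_rem.
have sz : size s = (size t).+1 by rewrite (perm_size st).
have /andP[z0 us'] := us.
have /andP[y0 ut] : upper_half_plane (y :: t).
  by rewrite /upper_half_plane -(perm_all _ st).
have h1 := IH (z :: t); have h2 := IH (y :: t).
rewrite /= -sz in h1 h2.
have {h1}h1 := h1 szn isT; have {h2}h2 := h2 szn isT.
rewrite /upper_half_plane /= z0 y0 -/(upper_half_plane t) in h1 h2.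
have {h1}h1 := h1 ut; have {h2}h2 := h2 ut.
(* The two shorter lists have equal size, so their [pole 'i] corrections cancel. *)
have h := has_line_integralCZ (z - y)^-1
  (has_line_integralCD h1 (has_line_integralCZ (-1) h2)).
rewrite mulr0 addr0 mulr0 in h.
apply: has_line_integralC_eq h => x.
rewrite sz /= mul0r subr0 !numE !big_cons (perm_big _ st) /= big_cons.
move: (\prod_(_ <- t) _) (_ == _)%:R (pole 'i%C x) => T e p.
have zx : x%:C - z != 0 by rewrite Im_neq0_sub // gt_eqF.
have yx : x%:C - y != 0 by rewrite Im_neq0_sub // gt_eqF.
have zy : z - y != 0 by rewrite subr_eq0 eq_sym.
by rewrite /pole; field; rewrite zx yx zy.
Qed.

(** Dividing [U] by ['X - z%:P] splits the fraction into one with the zero [z] removed and a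
    constant over the full denominator. The quotient keeps the top coefficient of [U], so the
    correction is unchanged. *)
Lemma fraction_line_integral s (U : {poly R[i]}) : s != [::] ->
  upper_half_plane s -> (size U <= size s)%N ->
  has_line_integralC
    (fun x => U.[x%:C] / (num_poly s).[x%:C] - U`_(size s).-1 * pole 'i%C x) 0.
Proof.
elim: s U => // z s IH U _ us szU.
have hinv := has_line_integralCZ (U.[z]) (@inv_num_poly_line_integral (z :: s) isT us).
rewrite mulr0 in hinv.
have [s0|s0] := eqVneq s [::].
  subst s; apply: has_line_integralC_eq hinv => x /=.
  have /size1_polyC -> := szU; rewrite !hornerC coefC /=; ring.
pose U1 := U %/ ('X - z%:P).
have UE : U = U1 * ('X - z%:P) + U.[z]%:P.
  by rewrite [LHS](divp_eq U ('X - z%:P)) modp_XsubC.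
have szU1 : (size U1 <= size s)%N.
  by rewrite size_divp ?polyXsubC_eq0 // size_XsubC /= leq_subLR.
have /andP[z0 us'] := us.
have h := has_line_integralCD (IH U1 s0 us' szU1) hinv.
rewrite addr0 in h; apply: has_line_integralC_eq h => x.
have sz1 : size s == 0%N = false by rewrite size_eq0 (negbTE s0).
rewrite /= eqSS sz1 mul0r subr0.
have cU : U`_(size s) = U1`_(size s).-1.
  case: (size s) (sz1) szU1 => // k _ szU1.
  rewrite UE coefD coefC /= addr0 mulrBr coefB coefMX /= coefMC.
  by rewrite [U1`_k.+1]nth_default // mul0r subr0.
rewrite cU !horner_num_poly big_cons -!horner_num_poly [in RHS]UE.
have zx : x%:C - z != 0 by rewrite Im_neq0_sub // gt_eqF.
have n0 := num_poly_neq0 x us'.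
rewrite hornerD hornerM hornerXsubC hornerC.
by field; rewrite zx n0.
Qed.

End partial_fractions.

(** * The residue formula and even integrands *)

Section general_quadrature.
Variable R : realType.
Implicit Types (s : seq R[i]) (w : R[i]) (x : R).

Lemma horner_conj_poly (p : {poly R[i]}) x :
  (map_poly conjc p).[x%:C] = (p.[x%:C])^*.
Proof.
by have := horner_map (@conjc R) p x%:C; rewrite /= oppr0.
Qed.

Lemma conj_pole (z : R[i]) x : (pole z x)^* = pole (z^*) x.
Proof.
rewrite /pole conjc_inv; congr (_^-1).
by rewrite rmorphB; congr (_ - _); exact: conjc_real.
Qed.

(** The substitution gives twice the integral of [g] over the half line. For even [g] the sum
    [P x + P (- x)] is constant, hence [p + q = 2 P 0], and [2 (p - P 0)] becomes [p - q]. *)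
Lemma has_line_integral_even (g : R -> R) (d : R) : has_line_integral g d ->
  (forall x, g (- x) = g x) ->
  (@lebesgue_measure R).-integrable `[0%R, +oo[
    (fun u => (g (Num.sqrt u) / Num.sqrt u)%:E) /\
  Rintegral (@lebesgue_measure R) `[0%R, +oo[
    (fun u => g (Num.sqrt u) / Num.sqrt u) = d.
Proof.
move=> [cg [C gC] [P [p [q [DP Pp Pq dE]]]]] ge.
have [i1 i2] := integral_sqrt_comp DP cg gC Pp; split=> //; rewrite i2.
have DPN x : is_derive x 1 (fun u : R => P u + P (- u)) 0.
  have h := @is_derive1_comp R P -%R x _ _ (DP (- x)) (is_deriveN (is_derive_id x 1)).
  apply: is_derive_eq (is_deriveD (DP x) h) _.
  by rewrite ge; ring.
have Pc x : P x + P (- x) = P 0 + P 0.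
  by have := is_derive_0_is_cst x 0 DPN; rewrite oppr0.
have lN : P (- x) @[x --> +oo] --> q by move/cvgNy_compNP: Pq.
have l1 : (P \+ (fun x => P (- x))) x @[x --> +oo] --> p + q by exact: cvgD.
have l2 : (P \+ (fun x => P (- x))) x @[x --> +oo] --> P 0 + P 0.
  by under eq_fun => x do rewrite /= Pc; exact: cvg_cst.
have pq : p + q = P 0 + P 0.
  exact: (cvg_unique (@Rhausdorff R) l1 l2).
by rewrite dE; lra.
Qed.

(** The term [V / K] is the conjugate of a fraction over [H], so it is reduced to the upper half
    plane. The two corrections combine to [u (1 / (x - i) - 1 / (x + i)) = 2 i u / (1 + x^2)], and
    the arctangent supplies the factor [pi]. *)
Lemma fraction_line_integral_residue s (A U V : {poly R[i]}) :
  s != [::] -> upper_half_plane s ->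
  (size U <= size s)%N -> (size V <= size s)%N ->
  A = U * den_poly s + V * num_poly s -> V`_(size s).-1 = - U`_(size s).-1 ->
  has_line_integralC (fun x => rfrac A (num_poly s * den_poly s) x%:C)
    (2 * 'i%C * pi%:C * U`_(size s).-1).
Proof.
move=> s0 us szU szV AE VU.
have hU := fraction_line_integral s0 us szU.
have szV' : (size (map_poly conjc V) <= size s)%N.
  by rewrite size_map_poly.
have := has_line_integralC_conj (fraction_line_integral s0 us szV').
rewrite conjc0 => hV.
have ha : has_line_integralC (fun x : R => ((1 + x ^+ 2)^-1)%:C) pi%:C.
  split; first exact: has_line_integral_atan.
  have := has_line_integralZ 0 (has_line_integral_atan R).
  by rewrite mul0r; under eq_fun => x do rewrite mul0r.
have h := has_line_integralCD (has_line_integralCD hU hV)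
  (has_line_integralCZ (2 * 'i%C * U`_(size s).-1) ha).
rewrite !add0r in h.
rewrite (_ : 2 * 'i%C * pi%:C * U`_(size s).-1 =
  2 * 'i%C * U`_(size s).-1 * pi%:C); last by ring.
apply: has_line_integralC_eq h => x.
have n0 := num_poly_neq0 x us; have d0 := den_poly_neq0 x us.
have conjV : ((map_poly conjc V).[x%:C])^* = V.[x%:C].
  by rewrite horner_conj_poly conjcK.
have -> : ((map_poly conjc V).[x%:C] / (num_poly s).[x%:C] -
    (map_poly conjc V)`_(size s).-1 * pole 'i%C x)^* =
    V.[x%:C] / (den_poly s).[x%:C] + U`_(size s).-1 * pole (- 'i%C) x.
  have cV : ((map_poly conjc V)`_(size s).-1)^* = - U`_(size s).-1.
    by rewrite coef_map -VU; exact: conjcK.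
  have ci : ('i%C)^* = - 'i%C :> R[i] by apply/eqP; rewrite eq_complex /= oppr0 !eqxx.
  rewrite rmorphB !rmorphM fmorphV -[U`__]opprK mulNr; congr (_ / _ - _ * _).
  - exact: conjV.
  - exact: conj_num_poly_real.
  - exact: cV.
  - by rewrite -ci; exact: conj_pole.
have i0 : x%:C - 'i%C != 0 by rewrite Im_neq0_sub //= oner_eq0.
have i1 : x%:C + 'i%C != 0.
  by rewrite -[X in _ + X]opprK Im_neq0_sub //= oppr_eq0 oner_eq0.
have ii : 'i%C * 'i%C = -1 :> R[i] by rewrite -expr2 sqr_i.
have xx : ((1 + x ^+ 2)^-1)%:C = ((x%:C - 'i%C) * (x%:C + 'i%C))^-1.
  by rewrite fmorphV rmorphD rmorphXn rmorph1 /=; congr (_^-1); rewrite -subr_sqr expr2 expr2 ii opprK addrC.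
rewrite xx /rfrac AE /pole opprK hornerD !hornerM.
move: 'i%C i0 i1 {ii xx ha hU hV} => i i0 i1.
by field; rewrite n0 d0 i0 i1.
Qed.

End general_quadrature.

(** * Quadrature at the notches of a Blaschke product *)

Section notch_quadrature.
Variable R : realType.
Implicit Types (s : seq R[i]) (w : R[i]) (x : R).

Lemma cvg_infty_phase_deriv s :
  x ^+ 2 * phase_deriv s x @[x --> infty_nbhs R] --> total_phase s.
Proof.
have Fy := infty_nbhs_proper R.
rewrite /total_phase /phase_deriv; elim: s => [|z s IH].
  by under eq_fun => x do rewrite big_nil mulr0; rewrite big_nil; exact: cvg_cst.
under eq_fun => x do rewrite big_cons mulrDr mulrCA; rewrite big_cons.
apply: cvgD => //; rewrite -[X in _ --> X]mulr1.
by apply: cvgM; [exact: cvg_cst|exact: cvg_infty_sqr_div_norm].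
Qed.

Lemma cvg_real_complex {T} (F : set_system T) (FF : Filter F) (f : T -> R) (l : R) :
  f @ F --> l -> (fun t : T => (f t)%:C : R[i]^o) @ F --> (l%:C : R[i]^o).
Proof.
move=> /cvgrPdist_lt fl; apply/cvgrPdist_lt => -[e e'] /=.
rewrite ltcE /= => /andP[/eqP -> e0].
apply: filterS (fl _ e0) => x xe.
by rewrite -rmorphB normc_def /= expr0n addr0 sqrtr_sqr ltcR.
Qed.

(** With [N = size s], the product [H K] grows like [x^(2 N)] and [phase_deriv] decays like
    [x^(-2)], so the quotient is balanced against degree [2 N - 2] in [A]. *)
Lemma cvg_infty_quotient s (A : {poly R[i]}) : s != [::] -> upper_half_plane s ->
  (size A < size s + size s)%N ->
  (fun x => rfrac A (num_poly s * den_poly s) x%:C / (phase_deriv s x)%:C : R[i]^o)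
    @ infty_nbhs R --> (A`_(size s + size s).-2 / (total_phase s)%:C : R[i]^o).
Proof.
move=> s0 us szA; have FF : Filter (infty_nbhs R) by have [] := infty_nbhs_proper R.
set N := size s.
have szA' : (size A <= (N + N).-2.+1)%N.
  by move: szA; rewrite -/N; case: (N) => // k; rewrite addSn addnS.
have lA := cvg_infty_poly szA'.
have lH := @cvg_infty_poly R (num_poly s) N _.
have lK := @cvg_infty_poly R (den_poly s) N _.
rewrite num_poly_top size_num_poly in lH; rewrite den_poly_top size_den_poly in lK.
have {lH}lH := lH (leqnn _); have {lK}lK := lK (leqnn _).
have lP := @cvg_real_complex R (infty_nbhs R) FF _ _ (@cvg_infty_phase_deriv s).
have tp0 : (total_phase s)%:C != 0 :> R[i].
  by rewrite fmorph_eq0 gt_eqF // total_phase_gt0.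
pose a x := A.[x%:C] / x%:C ^+ (N + N).-2.
pose b x := (num_poly s).[x%:C] / x%:C ^+ N * ((den_poly s).[x%:C] / x%:C ^+ N) *
   (x ^+ 2 * phase_deriv s x)%:C.
have lb : (b : R -> R[i]^o) @ infty_nbhs R --> ((total_phase s)%:C : R[i]^o).
  have lHK := @cvgM R[i] R (infty_nbhs R) FF _ _ _ _ lH lK.
  have := @cvgM R[i] R (infty_nbhs R) FF _ _ _ _ lHK lP.
  by rewrite !mul1r.
have lab : (fun x => a x / b x : R[i]^o) @ infty_nbhs R -->
    (A`_(N + N).-2 / (total_phase s)%:C : R[i]^o).
  exact: (@cvgM R[i] R (infty_nbhs R) FF _ _ _ _ lA
    (@cvgV R[i] R (infty_nbhs R) FF _ _ tp0 lb)).
apply: cvg_trans lab; apply: near_eq_cvg; exists 0 => // x /= x0.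
have xC0 : x%:C != 0 :> R[i] by rewrite fmorph_eq0 -normr_gt0.
have ph0 : (phase_deriv s x)%:C != 0 :> R[i].
  by rewrite fmorph_eq0 gt_eqF // phase_deriv_gt0.
have n0 := num_poly_neq0 x us; have d0 := den_poly_neq0 x us.
have NN : x%:C ^+ N * x%:C ^+ N = x%:C ^+ (N + N).-2 * x%:C ^+ 2 :> R[i].
  rewrite -!exprD; congr (_ ^+ _); rewrite /N; case: (s) s0 => // ? ? _.
  by rewrite /= addSn addnS addn2.
rewrite /a /b /rfrac hornerM rmorphM rmorphXn /=.
have x2 : x%:C ^+ (N + N).-2 != 0 by rewrite expf_neq0.
have xN : x%:C ^+ N != 0 by rewrite expf_neq0.
have -> : (num_poly s).[x%:C] / x%:C ^+ N * ((den_poly s).[x%:C] / x%:C ^+ N) *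
    (x%:C ^+ 2 * (phase_deriv s x)%:C) = (num_poly s).[x%:C] * (den_poly s).[x%:C] *
    (phase_deriv s x)%:C / x%:C ^+ (N + N).-2.
  have -> : x%:C ^+ (N + N).-2 = x%:C ^+ N * x%:C ^+ N / x%:C ^+ 2.
    by rewrite NN mulfK // expf_neq0.
  by field; rewrite xC0 xN.
by field; rewrite n0 d0 ph0 x2.
Qed.

Lemma coprimep_num_den s : upper_half_plane s ->
  coprimep (num_poly s) (den_poly s).
Proof.
move=> /allP us; apply: closed_coprimep => [|z].
  by rewrite -size_poly_gt0 size_num_poly.
have -> : den_poly s = \prod_(y <- map conjc s) ('X - y%:P) by rewrite big_map.
rewrite !root_prod_XsubC => /us z0 /mapP[y /us].
by case: y => a b /= b0 zE; move: z0; rewrite zE /= oppr_gt0 ltNge ltW.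
Qed.

Lemma notch_quadrature s w (A : {poly R[i]}) (ys : seq (option R)) :
  s != [::] -> upper_half_plane s -> `|w| = 1 -> (size A < size s + size s)%N ->
  uniq ys -> (forall y, y \in ys <-> oapp (blaschke s) 1 y = w) ->
  let f x := rfrac A (num_poly s * den_poly s) x%:C / (phase_deriv s x)%:C in
  exists L, [/\ (f : R -> R[i]^o) @ infty_nbhs R --> (L : R[i]^o) &
    has_line_integralC (fun x => rfrac A (num_poly s * den_poly s) x%:C)
      (2 * pi%:C * \sum_(y <- ys) oapp f L y)].
Proof.
move=> s0 us w1 szA uys ysP f.
have [U [V [szU szV AE]]] := coprimep_decomp (size_num_poly s) (size_den_poly s)
  (coprimep_num_den us) (ltnW szA).
have Ns : (0 < size s)%N by rewrite lt0n size_eq0.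
have VU : V`_(size s).-1 = - U`_(size s).-1.
  have : A`_((size s).-1 + size s) = 0.
    by rewrite nth_default // -ltnS -addSn prednK.
  rewrite AE coefD !coefM_top ?size_num_poly ?size_den_poly ?prednK //.
  rewrite num_poly_top den_poly_top !mulr1 => /eqP.
  by rewrite addrC addr_eq0 => /eqP.
exists (A`_(size s + size s).-2 / (total_phase s)%:C); split.
  exact: cvg_infty_quotient.
rewrite (notch_sum s0 us w1 szU szV AE szA uys ysP).
have := fraction_line_integral_residue s0 us szU szV AE VU.
by congr (has_line_integralC _ _); ring.
Qed.

End notch_quadrature.

(** * The rational fraction and its quadrature *)

Section poles.
Variables (R : realType) (nu : nat).
Implicit Types (r phi : 'I_nu -> R) (mult : 'I_nu -> nat) (x : R).

(** Halving the argument sends the plane cut along the half line onto the upper half plane. *)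
Lemma Im_zpt_gt0 r phi k : 0 < r k -> 0 < phi k < 2 * pi ->
  0 < complex.Im (zpt r phi k).
Proof.
move=> rk /andP[p0 p2]; rewrite /zpt /polar /expi /= mul0r addr0.
by rewrite mulr_gt0 ?sqrtr_gt0 // sin_gt0_pi // divr_gt0 //= ltr_pdivrMr // mulrC.
Qed.

Lemma zpt_sqr r phi k : 0 < r k -> zpt r phi k ^+ 2 = polar (r k) (phi k).
Proof.
move=> rk; rewrite /zpt /polar exprMn -rmorphXn /= sqr_sqrtr ?ltW //.
congr (_ * _); rewrite /expi [in RHS](splitr (phi k)) cosD sinD expr2.
by apply/eqP; rewrite eq_complex /= eqxx addrC mulrC eqxx.
Qed.

Lemma conj_zpt r phi k :
  (zpt r phi k)^* = polar (Num.sqrt (r k)) (- (phi k / 2)).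
Proof.
rewrite /zpt /polar /expi cosN sinN; apply/eqP.
by rewrite eq_complex /= !mul0r !addr0 subr0 mulrN !eqxx.
Qed.

(* In [ring_scope], [z^*] is [Num.conj z], which is convertible to [conjc z] but not
   recognized as such by [rewrite]. *)
Lemma conjN_conj (z : R[i]) : Num.conj (- Num.conj z) = - z.
Proof. by rewrite rmorphN; congr (- _); exact: conjCK. Qed.

(** Multiplicities become repetitions, the form in which the zeros of a Blaschke product are given
    above. *)
Definition pole_seq (p : 'I_nu -> R[i]) mult : seq R[i] :=
  flatten [seq nseq (mult k) (p k) | k <- enum 'I_nu].

Lemma prod_pole_seq (A : comNzRingType) (f : R[i] -> A) p mult :
  \prod_(z <- pole_seq p mult) f z = \prod_(k < nu) f (p k) ^+ mult k.
Proof.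
rewrite /pole_seq big_flatten big_map big_enum /=.
by apply: eq_bigr => k _; rewrite big_nseq iter_mulr_1.
Qed.

Lemma sum_pole_seq (f : R[i] -> R) p mult :
  \sum_(z <- pole_seq p mult) f z = \sum_(k < nu) f (p k) *+ mult k.
Proof.
rewrite /pole_seq big_flatten big_map big_enum /=.
by apply: eq_bigr => k _; rewrite big_nseq iter_addr_0.
Qed.

Lemma size_pole_seq (p : 'I_nu -> R[i]) mult :
  size (pole_seq p mult) = (\sum_(k < nu) mult k)%N.
Proof.
rewrite /pole_seq size_flatten /shape sumnE 2!big_map big_enum /=.
by apply: eq_bigr => k _; rewrite size_nseq.
Qed.

Lemma has_poles_factor (Q : {poly R[i]}) p mult : Q != 0 -> has_poles Q p mult ->
  Q = lead_coef Q *: \prod_(z <- pole_seq p mult) ('X - z%:P).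
Proof.
move=> Q0 [pinj proot pmult].
have lc0 : lead_coef Q != 0 by rewrite lead_coef_eq0.
have [rs QE] := closed_field_poly_normal Q.
suff pe : perm_eq rs (pole_seq p mult) by rewrite -(perm_big _ pe).
have mupQ z : mup z Q = count_mem z rs.
  rewrite QE -mul_polyC mupMr ?mu_prod_XsubC //.
  by rewrite rootE hornerC.
apply/allP => z _ /=; apply/eqP; rewrite -mupQ.
rewrite /pole_seq count_flatten sumnE 2!big_map big_enum /=.
have [/proot[k kz]|zQ] := boolP (root Q z).
  rewrite (bigD1 k) //= count_nseq kz /= eqxx mul1n big1 ?addn0 -?kz ?pmult //.
  by move=> j jk; rewrite count_nseq /= (inj_eq pinj) (negbTE jk).
rewrite mupNroot // big1 // => k _; rewrite count_nseq /=.
case: eqP => // kz; case/negP: zQ; apply/proot; by exists k.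
Qed.

(* The zeros of [Bstar ^+ m], all in the upper half plane. *)
Definition blaschke_zeros r phi mult m : seq R[i] :=
  flatten (nseq m (pole_seq (zpt r phi) mult ++
                   pole_seq (fun k => - (zpt r phi k)^*) mult)).

Lemma size_blaschke_zeros r phi mult m :
  size (blaschke_zeros r phi mult m) = (2 * m * \sum_(k < nu) mult k)%N.
Proof.
rewrite /blaschke_zeros size_flatten /shape map_nseq sumn_nseq size_cat.
by rewrite !size_pole_seq addnn -mul2n mulnAC.
Qed.

Lemma prod_blaschke_zeros (A : comNzRingType) (f : R[i] -> A) r phi mult m :
  \prod_(z <- blaschke_zeros r phi mult m) f z =
  (\prod_(k < nu) (f (zpt r phi k) * f (- (zpt r phi k)^*)) ^+ mult k) ^+ m.
Proof.
rewrite /blaschke_zeros big_flatten big_nseq iter_mulr_1 big_cat /= !prod_pole_seq.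
by rewrite -big_split /=; under eq_bigr => k _ do rewrite -exprMn.
Qed.

Lemma sum_blaschke_zeros (f : R[i] -> R) r phi mult m :
  \sum_(z <- blaschke_zeros r phi mult m) f z =
  (\sum_(k < nu) (f (zpt r phi k) + f (- (zpt r phi k)^*)) *+ mult k) *+ m.
Proof.
rewrite /blaschke_zeros big_flatten big_nseq iter_addr_0 big_cat /= !sum_pole_seq.
by rewrite -big_split /=; under eq_bigr => k _ do rewrite -mulrnDl.
Qed.

Lemma upper_blaschke_zeros r phi mult m : (forall k, 0 < r k) ->
  (forall k, 0 < phi k < 2 * pi) ->
  upper_half_plane (blaschke_zeros r phi mult m).
Proof.
move=> r0 p0; apply/allP => z /flattenP[_ /nseqP[-> _]].
rewrite mem_cat => /orP[] /flattenP[_ /mapP[k _ ->]] /nseqP[-> _].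
  exact: Im_zpt_gt0.
have := Im_zpt_gt0 (r0 k) (p0 k).
by case: (zpt r phi k) => a b /=; rewrite opprK.
Qed.

Lemma blaschke_zerosE r phi mult m x :
  blaschke (blaschke_zeros r phi mult m) x = Bstar r phi mult x ^+ m.
Proof.
rewrite /blaschke horner_num_poly horner_den_poly !prod_blaschke_zeros.
rewrite -expr_div_n -prodf_div; congr (_ ^+ _); apply: eq_bigr => k _.
rewrite -expr_div_n invfM mulrACA; congr ((_ / _ * (_ / _)) ^+ _).
  by rewrite opprK.
by rewrite conjN_conj opprK.
Qed.

Lemma phase_deriv_zeros r phi mult m x : phase_deriv (blaschke_zeros r phi mult m) x =
  2 * m%:R * mustar r phi mult x.
Proof.
rewrite /phase_deriv sum_blaschke_zeros -[LHS]mulr_natl [2 * _]mulrC -mulrA.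
congr (_ * _); rewrite /mustar mulr_sumr; apply: eq_bigr => k _.
rewrite -conj_zpt -/(zpt r phi k) opprK -[_ *+ mult k]mulr_natl.
have ImE : complex.Im (zpt r phi k) = Num.sqrt (r k) * sin (phi k / 2).
  by rewrite /zpt /polar /expi /= mul0r addr0.
have -> : complex.Im (- (zpt r phi k)^*) = complex.Im (zpt r phi k).
  by case: (zpt r phi k) => a b /=; rewrite opprK.
by rewrite ImE; ring.
Qed.

(** Since [z_k ^+ 2] is a root of [Q], each factor of [Q (x^2)] splits as [(x - z_k) (x + z_k)].
    Together with the conjugate factors these are the linear factors of [num_poly] and [den_poly],
    paired differently. *)
Lemma num_den_zeros (Q : {poly R[i]}) r phi mult m x : (forall k, 0 < r k) ->
  Q != 0 -> has_poles Q (fun k => polar (r k) (phi k)) mult ->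
  (num_poly (blaschke_zeros r phi mult m) *
   den_poly (blaschke_zeros r phi mult m)).[x%:C] =
  (Q.[(x ^+ 2)%:C] * (Q.[(x ^+ 2)%:C])^* / (lead_coef Q * (lead_coef Q)^*)) ^+ m.
Proof.
move=> r0 Q0 hQ.
have lc0 : lead_coef Q != 0 by rewrite lead_coef_eq0.
have lc0' : (lead_coef Q)^* != 0 by rewrite conjc_eq0.
have Qx : Q.[(x ^+ 2)%:C] = lead_coef Q *
    \prod_(k < nu) ((x%:C - zpt r phi k) * (x%:C + zpt r phi k)) ^+ mult k.
  rewrite [in LHS](has_poles_factor Q0 hQ) hornerZ horner_prod prod_pole_seq.
  congr (_ * _); apply: eq_bigr => k _; rewrite hornerXsubC -zpt_sqr //.
  by rewrite rmorphXn /= subr_sqr.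
rewrite hornerM horner_num_poly horner_den_poly !prod_blaschke_zeros -exprMn.
congr (_ ^+ _); rewrite Qx rmorphM rmorph_prod.
set a := \prod_(k < nu) _; set b := \prod_(k < nu) _.
set c := \prod_(k < nu) _; set d := \prod_(k < nu) _.
have -> : a * b = c * d.
  rewrite -!big_split /=; apply: eq_bigr => k _.
  rewrite conjN_conj !opprK rmorphXn.
  set z := zpt r phi k.
  have W : Num.conj ((x%:C - z) * (x%:C + z)) =
      (x%:C - Num.conj z) * (x%:C + Num.conj z).
    by rewrite rmorphM rmorphB rmorphD; congr ((_ - _) * (_ + _)); exact: conjc_real.
  rewrite -!exprMn; congr (_ ^+ _).
  transitivity ((x%:C - z) * (x%:C + z) *
    ((x%:C - Num.conj z) * (x%:C + Num.conj z))); first by ring.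
  by congr (_ * _); exact: esym.
by field; rewrite lc0 lc0'.
Qed.

End poles.

Section quadrature.
Variables (R : realType) (nu : nat).
Implicit Types (r phi : 'I_nu -> R) (mult : 'I_nu -> nat) (x : R).

Lemma Re_div_real (z : R[i]) x : complex.Re (z / x%:C) = complex.Re z / x.
Proof. by rewrite -fmorphV; case: z => a b /=; rewrite mulr0 subr0. Qed.

Lemma Im_div_real (z : R[i]) x : complex.Im (z / x%:C) = complex.Im z / x.
Proof. by rewrite -fmorphV; case: z => a b /=; rewrite mulr0 add0r. Qed.

Lemma has_integralC_even (h f : R -> R[i]) (d : R[i]) :
  has_line_integralC h d -> (forall x, h (- x) = h x) ->
  (forall u, 0 <= u -> f u = h (Num.sqrt u) / (Num.sqrt u)%:C) ->
  has_integralC `[0, +oo[ f d.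
Proof.
move=> [hr hi] hN fE.
have [ir vr] := has_line_integral_even hr (fun x => congr1 _ (hN x)).
have [ii vi] := has_line_integral_even hi (fun x => congr1 _ (hN x)).
have D u : u \in (`[0%R, +oo[%classic : set R) -> 0 <= u.
  by rewrite inE /= in_itv /= andbT.
split.
- apply: eq_integrable ir => // u /D u0.
  by rewrite fE // Re_div_real.
- apply: eq_integrable ii => // u /D u0.
  by rewrite fE // Im_div_real.
- under eq_Rintegral => u /D u0 do rewrite fE // Re_div_real.
  rewrite vr.
  under eq_Rintegral => u /D u0 do rewrite fE // Im_div_real.
  by rewrite vi; case: (d).
Qed.

Lemma expiD (s t : R) : expi (s + t) = expi s * expi t.
Proof.
rewrite /expi cosD sinD; apply/eqP; rewrite eq_complex /= eqxx.
by rewrite addrC eqxx.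
Qed.

Lemma norm_expi (t : R) : `|expi t| = 1.
Proof. by rewrite normc_def /= cos2Dsin2 sqrtr1. Qed.

Lemma expi_2pi_int (j : int) : expi (2 * pi * j%:~R) = 1 :> R[i].
Proof.
have e1 : expi (2 * pi) = 1 :> R[i].
  by rewrite /expi mulr_natl cos2pi sin2pi.
have en (n : nat) : expi (2 * pi * n%:R) = 1 :> R[i].
  elim: n => [|n IH]; first by rewrite mulr0 /expi cos0 sin0.
  by rewrite -[n.+1%:R]natr1 mulrDr mulr1 expiD IH e1 mulr1.
case: j => n; first exact: en.
have := expiD (2 * pi * (Negz n)%:~R) (2 * pi * n.+1%:R).
rewrite en mulr1 => <-; rewrite NegzE mulrNz mulrN addNr.
by rewrite /expi cos0 sin0.
Qed.

(** Common source of both formulas. Passing from [phase_deriv] to [mustar] costs the factor [2 m],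
    which turns [2 pi] into [pi / m]. The limit [L] is returned with its convergence, to be
    identified with the summand at infinity. *)
Lemma quadrature (n m N : nat) r phi mult (A : {poly R[i]}) (G : R -> R[i]) (t : R)
    (x : 'I_N -> option R) :
  (0 < n)%N -> (0 < m)%N -> (forall k, 0 < r k) ->
  (forall k, 0 < phi k < 2 * pi) -> (\sum_(k < nu) mult k)%N = n ->
  notches r phi mult m t x -> (size A < 4 * m * n)%N ->
  (forall u, G u = rfrac A (num_poly (blaschke_zeros r phi mult m) *
                            den_poly (blaschke_zeros r phi mult m)) u%:C) ->
  let f u := G u / (mustar r phi mult u)%:C in
  exists L, (f : R -> R[i]^o) @ infty_nbhs R --> (L : R[i]^o) /\
    has_line_integralC G ((pi / m%:R)%:C * \sum_(k < N) oapp f L (x k)).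
Proof.
move=> n0 m0 r0 p0 mn [xinj xP] szA GE f.
set s := blaschke_zeros r phi mult m in GE.
have szs : size s = (2 * m * n)%N by rewrite size_blaschke_zeros mn.
have s0 : s != [::] by rewrite -size_eq0 szs -lt0n !muln_gt0 m0 n0.
have us : upper_half_plane s by exact: upper_blaschke_zeros.
have szA' : (size A < size s + size s)%N by rewrite szs addnn -mul2n !mulnA.
have uys : uniq [seq x k | k <- enum 'I_N] by rewrite map_inj_uniq ?enum_uniq.
have ysP y : y \in [seq x k | k <- enum 'I_N] <-> oapp (blaschke s) 1 y = expi t.
  have -> : oapp (blaschke s) 1 y = Bstar_infty r phi mult y ^+ m.
    by case: y => [u|] /=; rewrite ?blaschke_zerosE ?expr1n.
  rewrite xP; split; first by case/mapP => k _ ->; exists k.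
  by case=> k <-; apply: map_f; rewrite mem_enum.
have [L [fL hL]] := notch_quadrature s0 us (norm_expi t) szA' uys ysP.
set f0 := (fun u => _) in fL hL.
have m0' : m%:R != 0 :> R[i] by rewrite pnatr_eq0 -lt0n.
have fE u : f u = 2 * m%:R * f0 u.
  rewrite /f /f0 phase_deriv_zeros GE.
  rewrite !rmorphM !rmorph_nat; move: (rfrac _ _ _) => a.
  have mu0 : (mustar r phi mult u)%:C != 0 :> R[i].
    have := phase_deriv_gt0 u s0 us; rewrite phase_deriv_zeros fmorph_eq0.
    by apply: contraTneq => ->; rewrite mulr0 ltxx.
  by field; rewrite mu0 m0'.
exists (2 * m%:R * L); split.
  have -> : f = (fun u => 2 * m%:R * f0 u) by apply/funext.
  have FF : Filter (infty_nbhs R) by have [] := infty_nbhs_proper R.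
  have cc : (fun _ : R => 2 * m%:R : R[i]^o) @ infty_nbhs R --> (2 * m%:R : R[i]^o).
    exact: cvg_cst.
  exact: (@cvgM R[i] R (infty_nbhs R) FF _ _ _ _ cc fL).
have -> : G = (fun u => rfrac A (num_poly s * den_poly s) u%:C) by apply/funext.
have -> : (pi / m%:R)%:C * \sum_(k < N) oapp f (2 * m%:R * L) (x k) =
   2 * pi%:C * \sum_(y <- [seq x k | k <- enum 'I_N]) oapp f0 L y; last by [].
rewrite big_map big_enum /= !mulr_sumr; apply: eq_bigr => k _.
have -> : oapp f (2 * m%:R * L) (x k) = 2 * m%:R * oapp f0 L (x k).
  by case: (x k) => [u|] //=; exact: fE.
rewrite fmorph_div rmorph_nat; move: (oapp _ _ _) => a.
by field.
Qed.

Lemma at_notchC_lim (f : R -> R[i]) (L : R[i]) y :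
  (f : R -> R[i]^o) @ infty_nbhs R --> (L : R[i]^o) -> at_notchC f y = oapp f L y.
Proof.
move=> fL; case: y => [u|] //=; have Fy := infty_nbhs_proper R.
exact: (@cvg_lim R[i]^o (@norm_hausdorff R[i] R[i]^o) _ _ Fy f L fL).
Qed.

End quadrature.

(** * Numerators and denominators on the real line *)

Section fraction_numerators.
Variables (R : realType) (nu : nat).
Implicit Types (r phi : 'I_nu -> R) (mult : 'I_nu -> nat) (x : R) (P Q : {poly R[i]}).

Lemma size_has_poles Q (p : 'I_nu -> R[i]) mult : Q != 0 -> has_poles Q p mult ->
  size Q = (\sum_(k < nu) mult k).+1.
Proof.
move=> Q0 hQ; rewrite (has_poles_factor Q0 hQ) size_scale ?lead_coef_eq0 //.
by rewrite size_prod_XsubC size_pole_seq.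
Qed.

(* With [c = lead_coef Q], the numerator of [R(x^2)] over the denominator
   [num_poly s * den_poly s = |Q(x^2) / c|^2] is [conj_mul_sqr c P Q], and the one of
   [|R(x^2)|^2] is [conj_mul_sqr c P P]. *)
Definition conj_mul_sqr (c : R[i]) P Q : {poly R[i]} :=
  (c * conjc c)^-1 *: ((P * map_poly conjc Q) \Po 'X^2).

(** One predecessor comes from the size of a product, the other from passing to the degree, which
    ['X^2] doubles. *)
Lemma size_conj_mul_sqr c P Q a b : (size P <= a)%N -> (size Q <= b)%N ->
  (size (conj_mul_sqr c P Q) <= ((a + b).-1.-1 * 2).+1)%N.
Proof.
move=> Pa Qb; rewrite (leq_trans (size_scale_leq _ _)) //.
rewrite (leq_trans (size_comp_poly_leq _ _)) // size_polyXn ltnS leq_mul2r /=.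
rewrite -!subn1 !leq_sub2r // (leq_trans (size_polyMleq _ _)) // -!subn1 leq_sub2r //.
by rewrite leq_add // size_map_poly.
Qed.

Lemma horner_conj_mul_sqr c P Q x : (conj_mul_sqr c P Q).[x%:C] =
  P.[(x ^+ 2)%:C] * conjc (Q.[(x ^+ 2)%:C]) / (c * conjc c).
Proof.
rewrite hornerZ horner_comp hornerXn -rmorphXn hornerM horner_conj_poly.
by rewrite mulrC.
Qed.

Lemma num_den_zerosE Q r phi mult m x : (forall k, 0 < r k) ->
  Q != 0 -> has_poles Q (fun k => polar (r k) (phi k)) mult ->
  (num_poly (blaschke_zeros r phi mult m) *
   den_poly (blaschke_zeros r phi mult m)).[x%:C] =
  (conj_mul_sqr (lead_coef Q) Q Q).[x%:C] ^+ m.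
Proof. by move=> r0 Q0 hQ; rewrite horner_conj_mul_sqr (num_den_zeros _ _ r0 Q0 hQ). Qed.

Lemma horner_sqr_neq0 Q r phi mult x : (forall k, 0 < r k) ->
  (forall k, 0 < phi k < 2 * pi) ->
  Q != 0 -> has_poles Q (fun k => polar (r k) (phi k)) mult ->
  Q.[(x ^+ 2)%:C] != 0.
Proof.
move=> r0 p0 Q0 hQ; have us := upper_blaschke_zeros mult 1 r0 p0.
have := num_den_zeros 1 x r0 Q0 hQ; rewrite hornerM expr1 => e.
apply/eqP => Qx; move/eqP: e; rewrite Qx !mul0r; apply/negP.
by rewrite mulf_neq0 // ?num_poly_neq0 ?den_poly_neq0.
Qed.

End fraction_numerators.

Theorem theorem2p3 (R : realType) (n nu : nat) (P Q : {poly R[i]})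
    (r phi : 'I_nu -> R) (mult : 'I_nu -> nat)
    (n_gt0 : (0 < n)%N)
    (PQ_proper : proper_fraction P Q)
    (r_gt0 : forall k, 0 < r k)
    (phi_itv : forall k, 0 < phi k < 2 * pi)
    (Q_poles : has_poles Q (fun k => polar (r k) (phi k)) mult)
    (deg_n : (\sum_(k < nu) mult k)%N = n) :
  [/\ (* existence of exactly 2mn notches *)
      forall (m : nat) (t : R), (0 < m)%N ->
        exists x : 'I_(2 * m * n) -> option R, notches r phi mult m t x,
      (* quadrature formula *)
      forall (t : R) (x : 'I_(2 * n) -> option R),
        notches r phi mult 1 t x ->
        has_integralC `[0, +oo[
          (fun u => rfrac P Q u%:C / (Num.sqrt u)%:C)
          (pi%:C * \sum_(k < 2 * n)
             at_notchC
               (fun u => rfrac P Q (u ^+ 2)%:C / (mustar r phi mult u)%:C) (x k)),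
      (* weighted norm *)
      forall (m : nat) (t : R) (x : 'I_(2 * m * n) -> option R), (0 < m)%N ->
        notches r phi mult m t x ->
        (\int[@lebesgue_measure R]_(u in `[0%R, +oo[)
           (Normc.normc (rfrac P Q u%:C) ^+ (2 * m) / Num.sqrt u)%:E =
         (pi / m%:R * \sum_(k < 2 * m * n)
            at_notch (fun u =>
              Normc.normc (rfrac P Q (u ^+ 2)%:C) ^+ (2 * m) /
              mustar r phi mult u)
              (x k))%:E)%E
    & (* the notch at infinity *)
      forall (m : nat) (t : R) (x : 'I_(2 * m * n) -> option R), (0 < m)%N ->
        notches r phi mult m t x -> (exists j : int, t = 2 * pi * j%:~R) ->
        exists k, x k = None].
Proof.
have [Q0 _ PQ] := PQ_proper.
have szQ := size_has_poles Q0 Q_poles; rewrite deg_n in szQ.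
have szP : (size P <= n)%N by rewrite -ltnS -szQ.
set c := lead_coef Q.
have c0 : c != 0 by rewrite lead_coef_eq0.
have c0' : conjc c != 0 by rewrite conjc_eq0.
have Qx0 x := horner_sqr_neq0 x r_gt0 phi_itv Q0 Q_poles.
have Qx0' x : conjc Q.[(x ^+ 2)%:C] != 0 by rewrite conjc_eq0.
split.
- move=> m t m0; set s := blaschke_zeros r phi mult m.
  have szs : size s = (2 * m * n)%N by rewrite size_blaschke_zeros deg_n.
  have s0 : s != [::] by rewrite -size_eq0 szs -lt0n !muln_gt0 m0 n_gt0.
  have us : upper_half_plane s by exact: upper_blaschke_zeros.
  have [rs _ [_ szys uys ysP]] := notch_seqP s0 us (norm_expi t).
  set ys := _ ++ _ in szys uys ysP; rewrite szs in szys.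
  exists (fun i => nth None ys i); split.
    by move=> i j /eqP; rewrite nth_uniq ?szys ?ltn_ord // => /eqP/val_inj.
  move=> y.
  have -> : Bstar_infty r phi mult y ^+ m = oapp (blaschke s) 1 y.
    by case: y => [u|] /=; rewrite ?blaschke_zerosE ?expr1n.
  rewrite -ysP; split.
    move=> yys; have iys : (index y ys < 2 * m * n)%N by rewrite -szys index_mem.
    by exists (Ordinal iys); rewrite /= nth_index.
  by case=> k <-; rewrite mem_nth // szys.
- move=> t x xN.
  pose G u := rfrac P Q (u ^+ 2)%:C.
  (* The degree is at most [2 (n - 1) + 2 n = 4 n - 2], so the bound is tight. *)
  have szA : (size (conj_mul_sqr c P Q) < 4 * 1 * n)%N.
    rewrite (leq_ltn_trans (size_conj_mul_sqr c szP (eq_leq szQ))) //.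
    by rewrite addnS /= muln1; lia.
  have GE u : G u = rfrac (conj_mul_sqr c P Q)
      (num_poly (blaschke_zeros r phi mult 1) *
       den_poly (blaschke_zeros r phi mult 1)) u%:C.
    rewrite /rfrac (num_den_zerosE _ _ r_gt0 Q0 Q_poles) expr1 -/c !horner_conj_mul_sqr.
    rewrite /G /rfrac; have := Qx0 u; have := Qx0' u.
    move: (conjc Q.[_]) => q' q'0 q0.
    by field; rewrite q0 q'0 c0 c0'.
  have [L [fL hL]] := quadrature n_gt0 (ltn0Sn 0) r_gt0 phi_itv deg_n xN szA GE.
  have -> : \sum_(k < 2 * n) at_notchC (fun u => rfrac P Q (u ^+ 2)%:C /
      (mustar r phi mult u)%:C) (x k) =
      \sum_(k < 2 * n) oapp (fun u => G u / (mustar r phi mult u)%:C) L (x k).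
    by apply: eq_bigr => k _; exact: at_notchC_lim.
  rewrite -[pi in pi%:C]divr1; apply: has_integralC_even hL _ _ => [u|u u0].
    by rewrite /G sqrrN.
  by rewrite /G sqr_sqrtr.
- move=> m t x m0 xN.
  pose g u := Normc.normc (rfrac P Q (u ^+ 2)%:C) ^+ (2 * m).
  pose A := conj_mul_sqr c P P ^+ m.
  (* The degree is at most [4 m (n - 1)], which leaves room because [m] is positive. *)
  have szA : (size A < 4 * m * n)%N.
    rewrite (leq_ltn_trans (size_poly_exp_leq _ _)) //.
    have := size_conj_mul_sqr c szP szP; rewrite -/(conj_mul_sqr c P P) => sz.
    have sz' : ((size (conj_mul_sqr c P P)).-1 <= (n + n).-1.-1 * 2)%N by lia.
    have := leq_mul sz' (leqnn m); nia.
  have GE u : (g u)%:C = rfrac A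
      (num_poly (blaschke_zeros r phi mult m) *
       den_poly (blaschke_zeros r phi mult m)) u%:C.
    rewrite /rfrac (num_den_zerosE _ _ r_gt0 Q0 Q_poles) /A horner_exp.
    rewrite -expr_div_n -/c !horner_conj_mul_sqr /g exprM rmorphXn; congr (_ ^+ _).
    have e1 : (Normc.normc (rfrac P Q (u ^+ 2)%:C) ^+ 2)%:C =
        rfrac P Q (u ^+ 2)%:C * conjc (rfrac P Q (u ^+ 2)%:C).
      by rewrite -sqr_normc normc_def rmorphXn /=; case: (rfrac _ _ _).
    rewrite [LHS]e1.
    have -> : conjc (rfrac P Q (u ^+ 2)%:C) =
        conjc P.[(u ^+ 2)%:C] / conjc Q.[(u ^+ 2)%:C].
      by rewrite /rfrac -conjc_inv; exact: rmorphM.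
    rewrite /rfrac; have := Qx0 u; have := Qx0' u.
    move: (conjc Q.[_]) (conjc P.[_]) => q' p' q'0 q0.
    by field; rewrite q0 q'0 c0 c0'.
  (* The integrand is real, so the real component of the complex quadrature carries the whole
     formula. *)
  have [L [fL [hL _]]] := quadrature n_gt0 m0 r_gt0 phi_itv deg_n xN szA GE.
  have gN u : g (- u) = g u by rewrite /g sqrrN.
  have [ig vg] := has_line_integral_even hL gN.
  have FF : Filter (infty_nbhs R) by have [] := infty_nbhs_proper R.
  have Fy := infty_nbhs_proper R.
  have limg : (g u / mustar r phi mult u) @[u --> infty_nbhs R] --> complex.Re L.
    under eq_fun => u do rewrite -[_ / _]/(complex.Re (g u)%:C / _) -Re_div_real.
    exact: (cvg_complex_Re FF fL).
  have -> : \sum_(k < 2 * m * n) at_notch (fun u => Normc.normc (rfrac P Q (u ^+ 2)%:C) ^+ (2 * m) /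
      mustar r phi mult u) (x k) =
      complex.Re (\sum_(k < 2 * m * n) oapp (fun u => (g u)%:C / (mustar r phi mult u)%:C) L (x k)).
    rewrite raddf_sum; apply: eq_bigr => k _; case: (x k) => [u|].
      exact: esym (Re_div_real (g u)%:C _).
    exact: (cvg_lim (@Rhausdorff R) limg).
  have ReM (a : R) (z : R[i]) : complex.Re (a%:C * z) = a * complex.Re z.
    by case: z => u v /=; rewrite mul0r subr0.
  (* Integrability makes the extended-real integral finite, so it equals its real value. *)
  rewrite -ReM -vg /Rintegral fineK; last exact: integrable_fin_num ig.
  apply: eq_integral => u; rewrite inE /= in_itv /= andbT => u0.
  by rewrite /g sqr_sqrtr.
- move=> m t x m0 [_ xP] [j tj]; apply/xP.
  by rewrite /= expr1n tj expi_2pi_int.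
Qed.
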